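(* Let $L\ge1$. For every $n\ge1$ let $g_n=([n]\times[L],E(g_n))$ be a grid graph, and suppose that the associated $\mathcal{M}_L$-decorated graphs $G_{g_n}$ converge in the decorated-graphon sense to an $\mathcal{M}_L$-decorated graphon $w$. Let $a\in\mathcal{A}$ be a self-adjoint normalized random variable (that is, $\tau(a)=0$ and $\tau(a^2)=1$) and, for each $n$, consider a family of $g_n$-independent and identically distributed (self-adjoint) random variables $(a_k^{(l)})_{k\in[n],l\in[L]}$ with common law that of $a$. For $J\in\mathcal{P}^*(L)$ define $$S_n^{(J)}=\frac1{\sqrt n}\sum_{k\in[n]}b_k^{(J)},\qquad b_k^{(J)}=\prod_{l\in J}a_k^{(l)}.$$ Then, as $n\to\infty$, the family $(S_n^{(I)})_{I\in\mathcal{P}^*(L)}$ converges in (joint $*$-)distribution to a family $(s_I)_{I\in\mathcal{P}^*(L)}$ whose joint distribution depends only on $w$. Moreover, for any $p\ge1$, $J\in\mathcal{P}^*(L)^p$ and $\alpha\in\{1,*\}^p$, $$\tau(s_{J_1}^{\alpha_1}\cdots s_{J_p}^{\alpha_p})=\sum_{\pi\in P_2^J(p)}\rho(F_{f_\pi}^{J,\alpha},w).$$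
   Context: Notation: $[n]=\{1,\dots,n\}$; all graphs are simple and loopless. $(\mathcal{A},\tau)$ is a noncommutative probability space (a unital $*$-algebra with a state $\tau$). For $t\in\{1,*\}$, $x^1=x$ and $x^*$ is the adjoint. $\mathcal{P}(L)$ (resp. $\mathcal{P}^*(L)$) is the collection of subsets (resp. nonempty subsets) of $[L]$. Products $\prod_{l\in J}a_k^{(l)}$ are in increasing order of $l$. Convergence in joint $*$-distribution means $\tau((S_n^{(J_1)})^{\alpha_1}\cdots(S_n^{(J_p)})^{\alpha_p})\to\tau(s_{J_1}^{\alpha_1}\cdots s_{J_p}^{\alpha_p})$ for all $p,J,\alpha$ (the limit may live in another noncommutative probability space, with state also denoted $\tau$). $g$-independence: for a loopless graph $g$ with finite vertex set $V$ and edge set $E$, subalgebras $(\mathcal{A}_v)_{v\in V}$ are $g$-independent if (1) for every $(i,j)\in E$, $\mathcal{A}_i,\mathcal{A}_j$ are classically independent (in particular they commute); (2) for every $k\ge1$ and $i\in V^k$ such that for all $j_1<j_2$ with $i_{j_1}=i_{j_2}$ there exists $j_1<j_3<j_2$ with $(i_{j_1},i_{j_3})\notin E$, one has $\tau(a_1\cdots a_k)=0$ for all centered $a_j\in\mathcal{A}_{i_j}$. Random variables are $g$-independent if the subalgebras they generate are; here $V=[n]\times[L]$ and $a_k^{(l)}$ is attached to the vertex $(k,l)$. Decorated graphons: $\mathcal{M}_L$ is the space of $[0,1]$-valued $2^L\times2^L$ matrices with rows and columns indexed by $\mathcal{P}(L)$, with $\langle S,T\rangle=\sum_{I,J\in\mathcal{P}(L)}S_{IJ}T_{IJ}$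 and the associated norm $\|\cdot\|_{\mathrm{HS}}$; $\mathbf{P}_{I,J}$ is the canonical basis matrix with entry $1$ at $(I,J)$ and $0$ elsewhere. An $\mathcal{M}_L$-decorated graphon is a (measurable) map $w:[0,1]^2\to\mathcal{M}_L$ with $\|w(x,y)\|_{\mathrm{HS}}=\|w(y,x)\|_{\mathrm{HS}}$ for all $x,y$. An $\mathcal{M}_L$-decorated graph is a pair $G=(g,\beta)$ with $g$ a finite graph and $\beta:E(g)\to\mathcal{M}_L$; if $V(g)=[n]$, its associated decorated graphon is $w_G(x,y)=\beta(i,j)$ for $(x,y)\in[\frac{i-1}n,\frac in)\times[\frac{j-1}n,\frac jn)$ (on diagonal blocks $i=j$ set $w_G=0$; this choice is asymptotically immaterial). For a decorated graph $F=(f,\beta)$ and a decorated graphon $w$, $\rho(F,w)=\int_{[0,1]^{V(f)}}\prod_{(u,v)\in E(f)}\langle\beta(u,v),w(x_u,x_v)\rangle\,\mathrm{d}x$ (each edge counted once, with an arbitrary fixed orientation). Decorated graphs $G_n$ converge to $w$ in the decorated-graphon sense if $\rho(F,w_{G_n})\to\rho(F,w)$ for every $\mathcal{M}_L$-decorated graph $F$. The decorated graph $G_{g_n}$: it is $(K_n,\gamma_n)$ with $K_n$ the complete graph on $[n]$ and, for $u\neq v\in[n]$ and $J_1,J_2,J\in\mathcal{P}^*(L)$, $(\gamma_n(u,v))_{J_1J_2}=\prod_{(l_1,l_2)\in J_1\times J_2}\mathbf 1_{((u,l_1),(v,l_2))\in E(g_n)}$, $(\gamma_n(u,v))_{J\varnothing}=\prod_{(l_1,l_2)\in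 J\times J,\,l_1\neq l_2}\mathbf 1_{((u,l_1),(u,l_2))\in E(g_n)}$, $(\gamma_n(u,v))_{\varnothing J}=\prod_{(l_1,l_2)\in J\times J,\,l_1\ne l_2}\mathbf 1_{((v,l_1),(v,l_2))\in E(g_n)}$, $(\gamma_n(u,v))_{\varnothing\varnothing}=1$. Partitions and the decorated graph $F_{f_\pi}^{J,\alpha}$: $P_2(p)$ is the set of pair partitions of $[p]$; for $\pi\in P_2(p)$ the intersection graph $f_\pi$ has the blocks of $\pi$ as vertices and an edge between two blocks if they cross. For $J\in\mathcal{P}^*(L)^p$, $P_2^J(p)=\{\pi\in P_2(p):J_r=J_s\ \forall\{r,s\}\in\pi\}$ and, for $\pi\in P_2^J(p)$ and $u=\{r,s\}\in\pi$, $J_u:=J_r=J_s$. Then $F_{f_\pi}^{J,\alpha}=(\tilde f_\pi,\beta_J)$, where $V(\tilde f_\pi)=V(f_\pi)\sqcup\{\xi\}$ with $\xi$ an extra vertex, $E(\tilde f_\pi)=E(f_\pi)\sqcup\{(\{r,s\},\xi):\{r,s\}\in\pi,\ \alpha_r=\alpha_s\}$, $\beta_J(u,v)=\mathbf{P}_{J_u,J_v}$ for $(u,v)\in E(f_\pi)$, and $\beta_J(u,\xi)=\mathbf{P}_{J_u,\varnothing}$, $\beta_J(\xi,u)=\mathbf{P}_{\varnothing,J_u}$. *)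

(* Defs.v *)
From HB Require Import structures.
From mathcomp Require Import all_boot all_order all_algebra.
From mathcomp Require Import all_classical all_reals all_analysis.
From mathcomp Require Import complex.

Set Implicit Arguments.
Unset Strict Implicit.
Unset Printing Implicit Defensive.

Import Order.TTheory GRing.Theory Num.Theory.
Import numFieldNormedType.Exports.

Local Open Scope classical_set_scope.
Local Open Scope complex_scope.
Local Open Scope ring_scope.

Record ncps (R : realType) := Ncps {
  ncps_alg :> algType R[i];
  adj : ncps_alg -> ncps_alg;
  tau : {scalar ncps_alg};
  adjK : forall x, adj (adj x) = x;
  adj_antilinear : forall (c : R[i]) x y,
    adj (c *: x + y) = c^* *: adj x + adj y;
  adjM : forall x y, adj (x * y) = adj y * adj x;
  tau1 : tau 1 = 1;
  tau_ge0 : forall x, 0 <= tau (adj x * x) }.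

Section NCProba.
Context {R : realType}.
Implicit Types A B : ncps R.

Definition is_subalg A (B : set A) : Prop :=
  [/\ B 1, forall (c : R[i]) x y, B x -> B y -> B (c *: x + y)
    & forall x y, B x -> B y -> B (x * y)].

(* Unital subalgebra generated by [a]. No closure under [adj] is imposed: it is
   automatic for a self-adjoint [a]. *)
Definition gen_subalg A (a : A) : set A := smallest (@is_subalg A) [set a].

Definition classically_independent A (B1 B2 : set A) : Prop :=
  forall x y, B1 x -> B2 y -> x * y = y * x /\ tau A (x * y) = tau A x * tau A y.

(* Two variables of a single noncommutative probability space, both
   self-adjoint, have the same law when all their moments agree. *)
Definition same_law A (x y : A) : Prop :=
  forall m : nat, tau A (x ^+ m) = tau A (y ^+ m).

(* [true] stands for the exponent [*] and [false] for the exponent [1]. *)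
Definition adj_pow A (t : bool) (x : A) : A := if t then adj x else x.

(* Big products over ['I_p] are taken in increasing order of the index. *)
Definition joint_moment A (I : Type) (s : I -> A) (p : nat) (J : 'I_p -> I)
    (alpha : 'I_p -> bool) : R[i] :=
  tau A (\prod_(r < p) adj_pow (alpha r) (s (J r))).

Definition converges_in_star_distribution A B (I : Type)
    (S : nat -> I -> A) (s : I -> B) : Prop :=
  forall (p : nat) (J : 'I_p -> I) (alpha : 'I_p -> bool),
    (fun n => joint_moment (S n) J alpha : R[i]^o) @ \oo
      --> (joint_moment s J alpha : R[i]^o).

Definition same_star_distribution A B (I : Type) (s : I -> A) (s' : I -> B) :
    Prop :=
  forall (p : nat) (J : 'I_p -> I) (alpha : 'I_p -> bool),
    joint_moment s J alpha = joint_moment s' J alpha.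

End NCProba.

Record sgraph (V : finType) := SGraph {
  edge : rel V;
  edge_sym : symmetric edge;
  edge_irr : irreflexive edge }.

Program Definition complete_graph (V : finType) : sgraph V :=
  @SGraph V (fun u v => u != v) _ _.
Next Obligation. by move=> V u v; rewrite eq_sym. Qed.
Next Obligation. by move=> V u; rewrite eqxx. Qed.

Definition graph_independent (R : realType) (A : ncps R) (V : finType)
    (g : sgraph V) (B : V -> set A) : Prop :=
  (forall u v, edge g u v -> classically_independent (B u) (B v)) /\
  (forall (k : nat) (i : 'I_k -> V), (0 < k)%N ->
     (forall j1 j2 : 'I_k, (j1 < j2)%N -> i j1 = i j2 ->
        exists j3 : 'I_k, [/\ (j1 < j3)%N, (j3 < j2)%N
                            & ~~ edge g (i j1) (i j3)]) ->
     forall a : 'I_k -> A, (forall j, B (i j) (a j)) ->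
       (forall j, tau A (a j) = 0) -> tau A (\prod_(j < k) a j) = 0).

Section Decorated.
Context {R : realType} {L : nat}.

(* The [0,1]-valued matrices whose rows and columns are indexed by the subsets
   of ['I_L]. *)
Record decoration := Decoration {
  entry :> {set 'I_L} -> {set 'I_L} -> R;
  entry01 : forall I J, 0 <= entry I J <= 1 }.

Definition dec_dot (S T : decoration) : R := \sum_I \sum_J S I J * T I J.

Definition dec_norm (S : decoration) : R := Num.sqrt (dec_dot S S).

Lemma indic01 (b : bool) : 0 <= (b%:R : R) <= 1.
Proof. by case: b; rewrite /= ?lexx ?ler01. Qed.

Definition dec_basis (I J : {set 'I_L}) : decoration :=
  @Decoration (fun I' J' => ((I' == I) && (J' == J))%:R) (fun _ _ => indic01 _).

Definition dec_zero : decoration :=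
  @Decoration (fun _ _ => false%:R) (fun _ _ => indic01 _).

(* A graphon is a function on [0,1]^2; the values of [w] outside of it are
   irrelevant. *)
Record dgraphon := DGraphon {
  dgraphon_fun :> R -> R -> decoration;
  dgraphon_measurable : forall I J,
    measurable_fun ([set` `[0, 1]%R] `*` [set` `[0, 1]%R] : set (R * R))
      (fun xy : R * R => dgraphon_fun xy.1 xy.2 I J);
  dgraphon_norm_sym : forall x y : R, 0 <= x <= 1 -> 0 <= y <= 1 ->
    dec_norm (dgraphon_fun x y) = dec_norm (dgraphon_fun y x) }.

(* The decoration of an edge depends on the direction in which it is read; the
   values of [dg_dec] at non-edges are irrelevant. *)
Record dgraph (V : finType) := DGraph {
  dg_graph :> sgraph V;
  dg_dec : V -> V -> decoration }.

Definition in_block (n : nat) (i : 'I_n) (x : R) : bool :=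
  i%:R / n%:R <= x < i.+1%:R / n%:R.

Definition graphon_of (n : nat) (G : dgraph 'I_n) (x y : R) : decoration :=
  if [pick ij : 'I_n * 'I_n | [&& in_block ij.1 x, in_block ij.2 y
                                & edge G ij.1 ij.2]] is Some ij
  then dg_dec G ij.1 ij.2 else dec_zero.

(* An arbitrary choice of an orientation of the edges of every graph, so that
   each edge contributes a single factor to [rho]. *)
Definition orientation := forall V : finType, sgraph V -> rel V.

Definition is_orientation (o : orientation) : Prop :=
  forall (V : finType) (g : sgraph V) (u v : V),
    edge g u v -> o V g u v = ~~ o V g v u.

(* Integral of [f] over [0,1]^V as an iterated Lebesgue integral over the
   coordinates listed in [s], those outside [s] being frozen at [x]. By Fubini
   this is the integral for the product measure when [f] is bounded and
   measurable, as in [rho]. *)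
Fixpoint cube_integral_seq (V : finType) (s : seq V) (f : (V -> R) -> R)
    (x : V -> R) : R :=
  if s is v :: s' then
    \int[lebesgue_measure]_(t in [set` `[0, 1]%R])
      cube_integral_seq s' f (fun u => if u == v then t else x u)
  else f x.

Definition cube_integral (V : finType) (f : (V -> R) -> R) : R :=
  cube_integral_seq (enum V) f (fun=> 0).

Definition rho (o : orientation) (V : finType) (F : dgraph V)
    (w : R -> R -> decoration) : R :=
  cube_integral (fun x : V -> R =>
    \prod_(uv : V * V | edge F uv.1 uv.2 && o V F uv.1 uv.2)
       dec_dot (dg_dec F uv.1 uv.2) (w (x uv.1) (x uv.2))).

Definition dgraph_converges (o : orientation) (G : forall n, dgraph 'I_n)
    (w : dgraphon) : Prop :=
  forall (V : finType) (F : dgraph V),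
    (fun n => rho o F (graphon_of (G n))) @ \oo --> rho o F w.

End Decorated.

Arguments decoration : clear implicits.
Arguments dgraphon : clear implicits.
Arguments dgraph : clear implicits.

Section GridGraph.
Context (R : realType) {L n : nat}.
Variable g : sgraph ('I_n * 'I_L)%type.

Definition gamma_clique (u : 'I_n) (J : {set 'I_L}) : R :=
  \prod_(l1 in J) \prod_(l2 in J | l1 != l2) (edge g (u, l1) (u, l2))%:R.

Definition gamma_entry (u v : 'I_n) (J1 J2 : {set 'I_L}) : R :=
  if J2 == finset.set0 then
    (if J1 == finset.set0 then 1 else gamma_clique u J1)
  else if J1 == finset.set0 then gamma_clique v J2
  else \prod_(l1 in J1) \prod_(l2 in J2) (edge g (u, l1) (v, l2))%:R.

Lemma prodr01 (I : finType) (P : pred I) (F : I -> R) :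
  (forall i, 0 <= F i <= 1) -> 0 <= \prod_(i | P i) F i <= 1.
Proof.
move=> F01; apply/andP; split.
  by apply: prodr_ge0 => i _; case/andP: (F01 i).
by apply: prodr_ile1 => i _; exact: F01.
Qed.

Lemma gamma_entry01 u v J1 J2 : 0 <= gamma_entry u v J1 J2 <= 1.
Proof.
have clique01 u' J : 0 <= gamma_clique u' J <= 1.
  by apply: prodr01 => l1; apply: prodr01 => l2; exact: indic01.
rewrite /gamma_entry; case: ifP => _; case: ifP => _ //.
  exact: (indic01 true).
by apply: prodr01 => l1; apply: prodr01 => l2; exact: indic01.
Qed.

Definition grid_dgraph : dgraph R L 'I_n :=
  DGraph (complete_graph 'I_n)
    (fun u v => Decoration (gamma_entry01 u v)).

End GridGraph.

Definition nzset (L : nat) := {J : {set 'I_L} | J != finset.set0}.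

Section PairPartitions.
Context (R : realType) {L p : nat}.

Definition pair_partition (pi : {set {set 'I_p}}) : bool :=
  finset.partition pi [set: 'I_p]%SET && [forall b in pi, #|b| == 2%N].

Definition compatible_pair_partition (J : 'I_p -> nzset L)
    (pi : {set {set 'I_p}}) : bool :=
  pair_partition pi &&
  [forall b in pi, forall r in b, forall s in b, J r == J s].

Definition interlaced (b c : {set 'I_p}) : bool :=
  [exists r1 in b, exists r2 in c, exists s1 in b, exists s2 in c,
     (r1 < r2 < s1)%N && (s1 < s2)%N].

Definition crossing (b c : {set 'I_p}) : bool :=
  (b != c) && (interlaced b c || interlaced c b).

Variables (J : 'I_p -> nzset L) (alpha : 'I_p -> bool).
Variable pi : {set {set 'I_p}}.

Definition block := {b : {set 'I_p} | b \in pi}.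

Program Definition intersection_graph : sgraph block :=
  @SGraph block (fun u v => crossing (val u) (val v)) _ _.
Next Obligation. by move=> u v; rewrite /crossing eq_sym orbC. Qed.
Next Obligation. by move=> u; rewrite /crossing eqxx. Qed.

Definition same_exponent (u : block) : bool :=
  [forall r in val u, forall s in val u, alpha r == alpha s].

(* [None] is the extra vertex xi. *)
Definition extended_edge (x y : option block) : bool :=
  match x, y with
  | Some u, Some v => edge intersection_graph u v
  | Some u, None | None, Some u => same_exponent u
  | None, None => false
  end.

Program Definition extended_graph : sgraph (option block) :=
  @SGraph (option block) extended_edge _ _.
Next Obligation. by case=> [u|] [v|] //=; exact: (edge_sym intersection_graph). Qed.
Next Obligation. by case=> [u|] //=; exact: (edge_irr intersection_graph). Qed.

(* For compatible [pi], the common value of [J] on the block. *)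
Definition block_label (u : block) : {set 'I_L} :=
  if [pick r in val u] is Some r then val (J r) else finset.set0.

Definition vertex_label (x : option block) : {set 'I_L} :=
  if x is Some u then block_label u else finset.set0.

Definition pairing_dgraph : dgraph R L (option block) :=
  DGraph extended_graph
    (fun x y => dec_basis (vertex_label x) (vertex_label y)).

End PairPartitions.

Section CLTVariables.
Context {R : realType} {L : nat} (A : ncps R).

Definition normalized (a : A) : Prop :=
  [/\ adj a = a, tau A a = 0 & tau A (a ^+ 2) = 1].

Definition graph_iid (n : nat) (g : sgraph ('I_n * 'I_L)%type) (a : A)
    (x : 'I_n -> 'I_L -> A) : Prop :=
  [/\ forall k l, adj (x k l) = x k l,
      forall k l, same_law (x k l) a
    & graph_independent g (fun v => gen_subalg (x v.1 v.2))].

Definition grid_sum (n : nat) (x : 'I_n -> 'I_L -> A) (J : nzset L) : A :=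
  ((Num.sqrt (n%:R : R))^-1)%:C *:
    \sum_(k < n) \prod_(l < L | l \in val J) x k l.

End CLTVariables.

(* Main.v *)
Require Import Defs.
From HB Require Import structures.
From mathcomp Require Import all_boot all_order all_algebra.
From mathcomp Require Import all_classical all_reals all_analysis.
From mathcomp Require Import measurable_realfun complex zify ring lra.

(**
Expanding a joint moment of the normalized sums gives a sum over maps k from the
p factors to [n] of the moments tau(b_(k_1) ... b_(k_p)). Each b_k is a product
of centered letters a_k^(l), and graph independence determines the moment of a
word: center the letters, and either the moment vanishes or two occurrences of
one vertex are separated only by neighbours of it and can be merged. Hence a
word containing a letter exactly once has moment 0, words of bounded length have
uniformly bounded moments, and a word in which every letter occurs exactly twice
has moment 1 if any two crossing letters are adjacent and 0 otherwise.

So only the maps k whose kernel is a pair partition contribute in the limit: if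
no fiber is a singleton and some fiber is larger than a pair, then k takes fewer
than p/2 values, which leaves O(n^((p-1)/2)) maps. For a pair partition, the
adjacency condition on the word says that crossing blocks are completely joined
and that blocks with equal exponents are cliques. Averaged over the values on
the blocks, its indicator is rho of the pairing graph in the step graphon of
G_n, up to non-injective assignments, which cost O(1/n). The extra vertex xi
accounts for the clique conditions.

The limit space is the *-algebra of sequences generated by the S_n^(J), with
state lim tau, which is positive as a limit of positive functionals.
*)

Set Implicit Arguments.
Unset Strict Implicit.
Unset Printing Implicit Defensive.

Import Order.TTheory GRing.Theory Num.Theory.
Import numFieldNormedType.Exports.

Local Open Scope complex_scope.
Local Open Scope ring_scope.

(** * Words of graph-independent letters *)

Section Words.
Variable K : numFieldType.

(** The negation of the separation condition in the second clause of [graph_independent]: some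
    vertex recurs with only neighbours of it in between. *)
Definition reducible (V : finType) (e : rel V) (w : seq (V * {poly K})) : Prop :=
  exists w1 v q w2 r w3,
    w = w1 ++ (v, q) :: w2 ++ (v, r) :: w3 /\ all (fun y => e v y.1) w2.

(* What graph independence of identically distributed variables says about the
   functional [T] sending the word [(v_1, q_1) ... (v_m, q_m)] to
   [tau (q_1(x_(v_1)) ... q_m(x_(v_m)))], where [phi q = tau (q(x_v))]. *)
Definition graph_functional (V : finType) (e : rel V) (phi : {poly K} -> K)
    (T : seq (V * {poly K}) -> K) : Prop :=
  [/\ T [::] = 1,
      forall w1 v q c w2, T (w1 ++ (v, q) :: w2) =
        T (w1 ++ (v, q - c%:P) :: w2) + c * T (w1 ++ w2),
      forall w1 v q w2 r w3, all (fun y => e v y.1) w2 ->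
        T (w1 ++ (v, q) :: w2 ++ (v, r) :: w3) =
        T (w1 ++ (v, q * r) :: w2 ++ w3)
    & forall w, w != [::] -> all (fun y => phi y.2 == 0) w ->
        ~ reducible e w -> T w = 0].

Definition centerable (phi : {poly K} -> K) : Prop :=
  forall q, phi (q - (phi q)%:P) = 0.

(** Induction measure for centering and merging. Merging removes a letter but may create one that is
    not centered, so a letter weighs twice as much as a failure to be centered. *)
Let excess (phi : {poly K} -> K) (qs : seq {poly K}) : nat :=
  (size qs).*2 + count (fun q => phi q != 0) qs.

Lemma excess_center phi (t1 t2 : seq {poly K}) q : centerable phi -> phi q != 0 ->
  (excess phi (t1 ++ (q - (phi q)%:P)%R :: t2) < excess phi (t1 ++ q :: t2))%N /\
  (excess phi (t1 ++ t2) < excess phi (t1 ++ q :: t2))%N.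
Proof.
move=> cphi q0; rewrite /excess !size_cat !count_cat /= q0 cphi eqxx /=.
by split; [rewrite add0n ltn_add2l ltn_add2l add1n|rewrite -!addnn]; lia.
Qed.

Lemma excess_merge phi (t1 t2 t3 : seq {poly K}) q r :
  all (fun q => phi q == 0) (t1 ++ q :: t2 ++ r :: t3) ->
  (excess phi (t1 ++ (q * r)%R :: t2 ++ t3) <
   excess phi (t1 ++ q :: t2 ++ r :: t3))%N.
Proof.
rewrite /excess !size_cat /= !size_cat /= !count_cat /= !count_cat /=.
rewrite all_cat /= all_cat /= => /and3P[h1 _ /and3P[h2 _ h3]].
have z t : all (fun q => phi q == 0) t -> count (fun q => phi q != 0) t = 0%N.
  elim: t => //= p t IH /andP[/eqP-> /IH->]; by rewrite eqxx.
by rewrite !z // -!addnn; case: (_ != 0); case: (_ != 0); case: (_ != 0) => /=; lia.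
Qed.

(** Induction on [excess]. The letter at [v] is already centered, and merging requires a repeated
    vertex, so neither operation touches it. It survives in every word produced, down to the
    centered irreducible ones, which are nonempty and on which [T] vanishes. *)
Lemma single_letter_vanish (V : finType) (e : rel V) phi T w v :
  centerable phi -> graph_functional e phi T ->
  count_mem v (map fst w) = 1%N -> (forall q, (v, q) \in w -> phi q = 0) ->
  T w = 0.
Proof.
move=> cphi [T1 Tlin Tmerge Tzero].
have [m] := ubnP (excess phi (map snd w)); elim: m w => // m IH w.
rewrite ltnS => wm cv vc.
have [/allP wc|/allPn[[u r] uw /= r0]] := boolP (all (fun y => phi y.2 == 0) w).
  have wa : all (fun y => phi y.2 == 0) w by exact/allP.
  have [|nr] := EM (reducible e w); last first.
    by apply: Tzero => //; case: {+}w cv.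
  move=> [w1 [u [q [w2 [r [w3 [wE w2e]]]]]]].
  have uv : u != v.
    apply: contra_eq_neq cv => uv; rewrite wE uv !map_cat /= map_cat /=.
    by rewrite count_cat /= count_cat /= eqxx; lia.
  rewrite wE Tmerge //; apply: IH.
  - apply: leq_trans wm; rewrite wE !map_cat /= !map_cat /=.
    apply: excess_merge; move: wa; rewrite wE.
    by rewrite !all_cat /= !all_cat /= !all_map.
  - move: cv; rewrite wE !map_cat /= !map_cat /= !count_cat /= !count_cat /=.
    by rewrite (negbTE uv) !add0n.
  - move=> p; rewrite !(mem_cat, inE) => h; apply: vc.
    rewrite wE !(mem_cat, inE); case/orP: h => [->//|].
    rewrite xpair_eqE eq_sym (negbTE uv) /=.
    by case/orP => ->; rewrite !orbT.
have uv : u != v by apply: contra r0 => /eqP uv; rewrite vc // -uv.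
have [w1 [w2 wE]] : exists w1 w2, w = w1 ++ (u, r) :: w2.
  by case/splitPr: uw => w1 w2; exists w1, w2.
have [lt1 lt2] := excess_center (map snd w1) (map snd w2) cphi r0.
have cv' c : count_mem v (map fst (w1 ++ (u, c) :: w2)) = 1%N.
  by rewrite -cv wE !map_cat.
rewrite wE (Tlin _ _ _ (phi r)) !IH ?mulr0 ?addr0 //.
- by rewrite map_cat; apply: leq_trans wm; rewrite wE map_cat.
- by move: cv; rewrite wE !map_cat !count_cat /= (negbTE uv).
- by move=> p pw; apply: vc; move: pw; rewrite wE !(mem_cat, inE) => /orP[]->;
    rewrite ?orbT.
- by rewrite map_cat; apply: leq_trans wm; rewrite wE map_cat.
- move=> p; rewrite !(mem_cat, inE) xpair_eqE eq_sym (negbTE uv) /= => pw.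
  by apply: vc; rewrite wE !(mem_cat, inE); case/orP: pw => ->; rewrite ?orbT.
Qed.

(** Merging is expressed through positions in the list of polynomials alone, because the bound in
    [word_bound] has to be fixed before the vertices are known. *)
Let merge_at (i j : nat) (qs : seq {poly K}) :=
  take i qs ++ (qs`_i * qs`_j) :: take (j - i.+1) (drop i.+1 qs) ++ drop j.+1 qs.

Lemma merge_atE t1 q t2 r t3 :
  merge_at (size t1) (size t1 + (size t2).+1) (t1 ++ q :: t2 ++ r :: t3) =
  t1 ++ (q * r) :: t2 ++ t3.
Proof.
rewrite /merge_at take_size_cat // !nth_cat ltnn subnn /=.
rewrite ltnNge leq_addr /= [X in nth _ _ X](_ : _ = (size t2).+1); last by lia.
rewrite /= nth_cat ltnn subnn /=.
rewrite !drop_cat /= ltnNge leqnSn /=.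
rewrite [(_.+1 - _)%N](_ : _ = 1%N) /=; last by lia.
rewrite drop0 ltnNge -addnS leq_addr /= ?drop0.
rewrite [X in take X](_ : _ = size t2); last by lia.
rewrite [(size t1 + _ - _)%N](_ : _ = (size t2).+2); last by lia.
rewrite /= take_size_cat //; congr (_ ++ _ :: _ ++ _).
by rewrite drop_cat ltnNge leqnSn /= subSn // subnn /= drop0.
Qed.

(* Centering and merging replace [qs] by finitely many other lists, whatever the
   word and the graph; hence a bound depending on [qs] only. *)
Lemma word_bound phi (qs : seq {poly K}) : centerable phi ->
  exists C : K, forall (V : finType) (e : rel V) T w,
    graph_functional e phi T -> map snd w = qs -> `|T w| <= C.
Proof.
move=> cphi.
have [m] := ubnP (excess phi qs); elim: m qs => // m IH qs.
rewrite ltnS => qm.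
have [qc|/allPn[q qqs /= q0]] := boolP (all (fun q => phi q == 0) qs); last first.
  have [t1 [t2 qE]] : exists t1 t2, qs = t1 ++ q :: t2.
    by case/splitPr: qqs => t1 t2; exists t1, t2.
  have [lt1 lt2] := excess_center t1 t2 cphi q0.
  rewrite qE in qm.
  have [C1 H1] := IH _ (leq_trans lt1 qm).
  have [C2 H2] := IH _ (leq_trans lt2 qm).
  exists (C1 + `|phi q| * C2) => V e T w gT wE.
  have [w1 [v [w2 [-> w1E w2E]]]] : exists w1 v w2,
      [/\ w = w1 ++ (v, q) :: w2, map snd w1 = t1 & map snd w2 = t2].
    rewrite qE in wE; clear -wE; elim: t1 w wE => [|p t1 IH] [|[v r] w] //= [-> E].
      by exists [::], v, w.
    have [w1 [v' [w2 [-> E1 E2]]]] := IH _ E.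
    by exists ((v, p) :: w1), v', w2; rewrite /= E1.
  have [_ Tlin _ _] := gT; rewrite (Tlin _ _ _ (phi q)).
  apply: le_trans (ler_normD _ _) _; apply: lerD.
    by apply: H1 gT _; rewrite map_cat /= w1E w2E.
  rewrite normrM ler_wpM2l //; apply: H2 gT _.
  by rewrite map_cat w1E w2E.
(* One bound for each pair of positions at which a word over [qs] may be merged, valid for all
   graphs, functionals and words at once. *)
have /choice[C HC] : forall ij : 'I_(size qs) * 'I_(size qs), exists C : K,
   forall (V : finType) (e : rel V) T w, graph_functional e phi T ->
     map snd w = qs -> forall w1 v q w2 r w3,
       w = w1 ++ (v, q) :: w2 ++ (v, r) :: w3 ->
       size w1 = ij.1 -> (size w1 + (size w2).+1)%N = ij.2 ->
       all (fun y => e v y.1) w2 -> `|T w| <= C.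
  move=> [[i il] [j jl]] /=.
  have [lt|nlt] := pselect (excess phi (merge_at i j qs) < m)%N.
    have [C HC] := IH _ lt; exists C => V e T w gT wE w1 v q w2 r w3 wE' iE jE w2e.
    have [_ _ Tmerge _] := gT; rewrite wE' Tmerge //; apply: HC (gT) _.
    rewrite -wE wE' -iE -jE !map_cat /= !map_cat /=.
    by rewrite -(size_map snd w1) -(size_map snd w2) merge_atE.
  (* If the merged list is not smaller, no word over [qs] can be reduced at these positions, by
     [excess_merge]; the bound [0] is then vacuous. *)
  exists 0 => V e T w gT wE w1 v q w2 r w3 wE' iE jE w2e.
  exfalso; apply: nlt; apply: leq_trans qm.
  rewrite -wE wE' -iE -jE !map_cat /= !map_cat /=.
  rewrite -(size_map snd w1) -(size_map snd w2) merge_atE.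
  apply: excess_merge.
  by move: qc; rewrite -wE wE' !map_cat /= !map_cat /=.
(* The [1] covers the empty word and the sum dominates the bound of whichever pair gets merged; a
   nonempty irreducible word has value 0. *)
exists (1 + \sum_ij `|C ij|) => V e T w gT wE.
have C0 : 0 <= \sum_ij `|C ij| by apply: sumr_ge0.
have [T1 _ _ Tzero] := gT.
have [->|w0] := eqVneq w [::].
  by rewrite T1 normr1 lerDl.
have [|nr] := EM (reducible e w); last first.
  rewrite Tzero // ?normr0 ?addr_ge0 //.
  by move: qc; rewrite -wE all_map.
move=> [w1 [v [q [w2 [r [w3 [wE' w2e]]]]]]].
have sE : size qs = (size w1 + (size w2).+1 + (size w3).+1)%N.
  by rewrite -wE wE' size_map size_cat /= size_cat /= ; lia.
have lt1 : (size w1 < size qs)%N by rewrite sE; lia.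
have lt2 : (size w1 + (size w2).+1 < size qs)%N by rewrite sE; lia.
have H := HC (Ordinal lt1, Ordinal lt2) V e T w gT wE _ _ _ _ _ _ wE' erefl erefl w2e.
have CC : 0 <= C (Ordinal lt1, Ordinal lt2) by exact: le_trans H.
apply: le_trans H _; rewrite (bigD1 (Ordinal lt1, Ordinal lt2)) //=.
rewrite ger0_norm // addrCA lerDl addr_ge0 // sumr_ge0 //.
Qed.

(* When every vertex of [s] occurs at most twice, a subsequence [u v u v] is a
   crossing of the pair of occurrences of [u] with that of [v]. *)
Definition crossings_adjacent (V : finType) (e : rel V) (s : seq V) : Prop :=
  forall u v, u != v -> subseq [:: u; v; u; v] s -> e u v.

Lemma subseq_cons_notin (T : eqType) (v : T) s1 s2 t :
  v \notin s1 -> subseq (v :: t) (s1 ++ s2) = subseq (v :: t) s2.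
Proof.
elim: s1 => //= y s1 IH; rewrite inE negb_or => /andP[/negbTE-> /IH] //.
Qed.

(** Since [x] occurs exactly twice, a vertex crossing it has an occurrence in [s2] and is adjacent
    to [x] by hypothesis. Patterns not involving [x] survive its deletion. *)
Lemma crossings_adjacent_remove (V : finType) (e : rel V) (x : V) s1 s2 s3 :
  symmetric e -> x \notin s1 ++ s2 ++ s3 -> all (e x) s2 ->
  crossings_adjacent e (s1 ++ x :: s2 ++ x :: s3) <->
  crossings_adjacent e (s1 ++ s2 ++ s3).
Proof.
move=> esym xs s2e; split=> H u v uv sub.
  apply: H => //; apply: subseq_trans sub _.
  apply: cat_subseq => //; apply: subseq_trans (subseq_cons _ _).
  by apply: cat_subseq => //; exact: subseq_cons.
have [ux|ux] := eqVneq u x.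
  subst u; move: xs; rewrite !mem_cat !negb_or => /and3P[x1 x2 x3].
  apply: (allP s2e); apply: contraT => v2; move: sub.
  rewrite subseq_cons_notin //= eqxx subseq_cons_notin //= eq_sym (negbTE uv).
  move=> /mem_subseq /(_ x); rewrite !inE eqxx orbT => /(_ isT) xs3.
  by rewrite xs3 in x3.
have [vx|vx] := eqVneq v x.
  subst v; rewrite esym; move: xs; rewrite !mem_cat !negb_or => /and3P[x1 x2 x3].
  apply: (allP s2e); apply: contraT => v2.
  have /= := subseq_trans (subseq_cons [:: x; u; x] u) sub.
  rewrite subseq_cons_notin //= eqxx subseq_cons_notin //= (negbTE uv).
  move=> /mem_subseq /(_ x); rewrite !inE eqxx orbT => /(_ isT) xs3.
  by rewrite xs3 in x3.
apply: H => //.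
have fid t : x \notin t -> seq.filter (predC1 x) t = t.
  move=> xt; apply/all_filterP/allP => y yt /=.
  by apply: contraNneq xt => <-.
rewrite -[s1 ++ s2 ++ s3]fid //.
have -> : seq.filter (predC1 x) (s1 ++ s2 ++ s3) =
    seq.filter (predC1 x) (s1 ++ x :: s2 ++ x :: s3).
  by rewrite !filter_cat /= !filter_cat /= eqxx.
by rewrite subseq_filter sub /= ux vx.
Qed.

(** Induction on the length. If the word is reducible, the merged pair can be deleted without
    changing either side. If it is not, the letters are centered and [T] vanishes, while a closest
    pair of equal letters yields a crossing of non-adjacent vertices. *)
Lemma pairing_word_value (V : finType) (e : rel V) phi T (s : seq V) :
  symmetric e -> centerable phi -> phi 'X = 0 -> phi ('X * 'X) = 1 ->
  graph_functional e phi T ->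
  (forall v, v \in s -> count_mem v s = 2%N) ->
  T [seq (v, 'X) | v <- s] = (`[< crossings_adjacent e s >])%:R.
Proof.
move=> esym cphi phiX phiXX gT.
have [T1 Tlin Tmerge Tzero] := gT.
have [m] := ubnP (size s); elim: m s => // m IH s; rewrite ltnS => sm s2.
have [->|s0] := eqVneq s [::].
  by rewrite T1; case: asboolP => // -[] u v _.
pose red := exists s1 x s2 s3, s = s1 ++ x :: s2 ++ x :: s3 /\ all (e x) s2.
have [|nred] := EM red.
  move=> [t1 [x [t2 [t3 [sE t2e]]]]].
  have xs : x \notin t1 ++ t2 ++ t3.
    have := s2 x; rewrite sE !mem_cat inE eqxx orbT => /(_ isT).
    rewrite count_cat /= count_cat /= eqxx -[nat_of_bool true]/1%N => E.
    rewrite -!mem_cat -has_pred1 has_count -eqn0Ngt !count_cat; move: E.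
    by move: (count _ t1) (count _ t2) (count _ t3); clear; lia.
  rewrite sE !map_cat /= !map_cat /= Tmerge; last by rewrite all_map.
  (* The merged letter is ['X * 'X], of mean 1. Its centered part is the only letter at [x], so that
     term vanishes and the word without [x] remains. *)
  rewrite (Tlin _ _ _ 1) (@single_letter_vanish _ e phi _ _ x) //; last 2 first.
  - rewrite map_cat /= map_cat -!map_comp !map_id_in // count_cat /= count_cat eqxx.
    move: xs; rewrite !mem_cat -!has_pred1 !has_count !negb_or -!eqn0Ngt.
    by move=> /and3P[/eqP-> /eqP-> /eqP->].
  - move=> q; have nm t : x \notin t -> ((x, q) \in [seq (v, 'X) | v <- t]) = false.
      by move=> xt; apply/mapP => -[y yt [xy _]]; rewrite xy yt in xt.
    move: xs; rewrite !mem_cat !negb_or inE => /and3P[x1 x2 x3].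
    rewrite !mem_cat !nm //= orbF => /eqP[->].
    by rewrite -phiXX cphi.
  rewrite add0r mul1r -!map_cat IH.
  - by congr (_%:R); congr nat_of_bool; apply/asbool_equiv_eq; apply: iff_sym;
      exact: crossings_adjacent_remove.
  - by apply: leq_trans sm; rewrite sE !size_cat /= size_cat /=; lia.
  - move=> v vs; have vx : v != x by apply: contraNneq xs => <-.
    have := s2 v; rewrite sE !(mem_cat, inE) (negbTE vx) /= -!mem_cat => /(_ vs).
    by rewrite !count_cat /= !count_cat /= eq_sym (negbTE vx).
have nadj : ~ crossings_adjacent e s.
  move=> adj; apply: nred.
  (* Between two closest occurrences of a vertex no vertex is repeated, so each
     of the vertices between them crosses it. *)
  have [t1 [x [t2 [t3 [sE xt2]]]]] : exists t1 x t2 t3,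
      s = t1 ++ x :: t2 ++ x :: t3 /\ uniq (x :: t2).
    have : ~~ uniq s.
      case: {+}s s0 s2 => // y t _ /(_ y); rewrite inE eqxx => /(_ isT) c.
      by apply/negP => us; rewrite (count_uniq_mem y us) mem_head in c.
    clear; elim/last_ind: s => // s x IH.
    rewrite rcons_uniq negb_and negbK => h.
    have [us|] := boolP (uniq s); last first.
      move=> /IH[t1 [y [t2 [t3 [-> ?]]]]]; exists t1, y, t2, (rcons t3 x).
      by rewrite !rcons_cat /= !rcons_cat.
    rewrite us orbF in h; case/splitPr: h us => t1 t2.
    rewrite cat_uniq => /and3P[_ _ u2]; exists t1, x, t2, [::].
    by rewrite rcons_cat /= -cats1.
  exists t1, x, t2, t3; split=> //; apply/allP => u ut2.
  have ux : u != x by apply: contraTneq ut2 => ->; case/andP: xt2.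
  have := s2 u; rewrite sE !(mem_cat, inE) ut2 !orbT => /(_ isT).
  rewrite count_cat /= count_cat /= eq_sym (negbTE ux) /= !add0n.
  have /andP[_ ut] := xt2; rewrite (count_uniq_mem u ut) ut2.
  move=> c.
  have sub t : u \in t -> subseq [:: u] t by rewrite sub1seq.
  have : (u \in t1) || (u \in t3).
    rewrite -!has_pred1 !has_count; move: c.
    by move: (count _ t1) (count _ t3); clear; rewrite /=; lia.
  (* The other occurrence of [u] lies to the left or to the right of the pair, which gives the
     pattern [u x u x] or [x u x u]. *)
  case/orP => h.
    rewrite esym; apply: adj => //; rewrite sE.
    rewrite (_ : [:: u; x; u; x] = [:: u] ++ (x :: [:: u] ++ [:: x])) //.
    apply: cat_subseq; first exact: sub.
    by rewrite /= eqxx -/(cat [:: u] _); apply: (@cat_subseq _ [:: u] [:: x]);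
      [exact: sub|rewrite sub1seq mem_head].
  apply: adj; first by rewrite eq_sym.
  rewrite sE; apply: (@subseq_trans _ (x :: t2 ++ x :: t3)); last exact: suffix_subseq.
  rewrite /= eqxx; apply: (@cat_subseq _ [:: u] [:: x; u]); first exact: sub.
  by rewrite /= eqxx; exact: sub.
rewrite asboolF // Tzero //; first by case: {+}s s0.
  by rewrite all_map; apply/allP => v _ /=; rewrite phiX.
move=> [w1 [v [q [w2 [r [w3 [wE w2e]]]]]]]; apply: nred.
exists (map fst w1), v, (map fst w2), (map fst w3); split.
  have := congr1 (map fst) wE.
  by rewrite !map_cat /= map_cat /= -map_comp map_id_in.
by rewrite all_map.
Qed.

End Words.

(** * Expansion of joint moments *)

Section Expansion.
Context {R : realType} (A : ncps R).
Implicit Types (a b : A).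

Lemma nc_adj1 : adj (1 : A) = 1.
Proof.
have H b : adj (1 : A) * b = b by rewrite -[b]adjK -adjM mulr1.
by rewrite -[LHS]mulr1 H.
Qed.

Lemma nc_adjD a b : adj (a + b) = adj a + adj b.
Proof. by rewrite -[a in LHS]scale1r adj_antilinear rmorph1 scale1r. Qed.

Lemma nc_adj0 : adj (0 : A) = 0.
Proof. by apply: (@addrI _ (adj (0 : A))); rewrite -nc_adjD !addr0. Qed.

Lemma nc_adjZ c a : adj (c *: a) = c^* *: adj a.
Proof. by rewrite -[c *: a]addr0 adj_antilinear nc_adj0 addr0. Qed.

Lemma adj_prod (I : Type) (s : seq I) (F : I -> A) :
  adj (\prod_(i <- s) F i) = \prod_(i <- rev s) adj (F i).
Proof.
elim: s => [|i s IH]; first by rewrite !big_nil nc_adj1.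
by rewrite big_cons adjM IH rev_cons -cats1 big_cat big_seq1.
Qed.

(* [big_enum] needs commutativity. *)
Lemma prod_enum (I : finType) (D : {pred I}) (F : I -> A) :
  \prod_(i <- enum D) F i = \prod_(i in D) F i.
Proof. by rewrite -[RHS]big_filter [index_enum _]unlock. Qed.

Lemma adj_sum (I : Type) (s : seq I) (F : I -> A) :
  adj (\sum_(i <- s) F i) = \sum_(i <- s) adj (F i).
Proof. exact: (big_morph _ nc_adjD nc_adj0). Qed.

Definition eval_word (V : Type) (x : V -> A) (w : seq (V * {poly R[i]})) : A :=
  \prod_(y <- w) horner_alg (x y.1) y.2.

Definition law_of a (q : {poly R[i]}) : R[i] := tau A (horner_alg a q).

Lemma gen_subalg_subalg a : is_subalg (gen_subalg a).
Proof.
split.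
- by move=> B [[B1 _ _] _].
- by move=> c y z hy hz B hB; have [[_ H _] _] := hB; apply: H; [exact: hy|exact: hz].
- by move=> y z hy hz B hB; have [[_ _ H] _] := hB; apply: H; [exact: hy|exact: hz].
Qed.

Lemma gen_subalg_horner a q : gen_subalg a (horner_alg a q).
Proof.
have [S1 SL SM] := gen_subalg_subalg a.
have S0 : gen_subalg a 0 by have := SL (-1) _ _ S1 S1; rewrite scaleN1r addNr.
elim/poly_ind: q => [|q c IH]; first by rewrite rmorph0.
rewrite rmorphD rmorphM /= horner_algX horner_algC addrC; apply: SL => //.
by apply: SM => // B [_ /(_ a)]; apply.
Qed.

Lemma horner_algE a q : horner_alg a q = \sum_(i < size q) q`_i *: a ^+ i.
Proof.
rewrite -[q in LHS]coefK poly_def linear_sum; apply: eq_bigr => i _.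
by rewrite linearZ /= rmorphXn /= horner_algX -scalerAl mul1r.
Qed.

Lemma law_of_same a b q : same_law a b -> law_of a q = law_of b q.
Proof.
move=> ab; rewrite /law_of !horner_algE !linear_sum; apply: eq_bigr => i _.
by rewrite !linearZ /= ab.
Qed.

Lemma centerable_law a : centerable (law_of a).
Proof.
move=> q; rewrite /law_of rmorphB /= horner_algC linearB linearZ /= tau1.
by rewrite mulr1 subrr.
Qed.

(** Centering is linearity of [tau]. Merging holds because adjacent variables commute, so the second
    letter can be moved next to the first. Vanishing is the second clause of [graph_independent], as
    polynomials in [x v] lie in the generated subalgebra. *)
Lemma graph_functional_tau (V : finType) (g : sgraph V) (x : V -> A) a :
  (forall v, same_law (x v) a) ->
  graph_independent g (fun v => gen_subalg (x v)) ->
  graph_functional (edge g) (law_of a) (fun w => tau A (eval_word x w)).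
Proof.
move=> xa [gC gF]; rewrite /eval_word; split.
- by rewrite big_nil tau1.
- move=> w1 v q c w2; rewrite !big_cat !big_cons /= -linearZ -linearD /=.
  congr (tau A _); rewrite rmorphB /= horner_algC mulrBl mulrBr.
  by rewrite -!scalerAl mul1r -scalerAr subrK.
- move=> w1 v q w2 r w3 w2e; congr (tau A _).
  rewrite !big_cat !big_cons /= !big_cat !big_cons /= rmorphM /=.
  rewrite -!mulrA; congr (_ * (_ * _)); rewrite !mulrA; congr (_ * _).
  elim: w2 w2e => [|y w2 IH] /=; first by rewrite big_nil mul1r mulr1.
  move=> /andP[vy /IH {}IH]; rewrite big_cons -mulrA IH !mulrA; congr (_ * _).
  have [-> //] := gC _ _ vy _ _ (@gen_subalg_horner (x v) r)
    (@gen_subalg_horner (x y.1) y.2).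
- case=> // y0 w'; set w := y0 :: w' => _ wc nr; rewrite (big_nth y0) big_mkord.
  apply: (gF _ (fun j : 'I_(size w) => (nth y0 w j).1)) => //.
  + move=> j1 j2 j12 ij.
    (* Cutting the word at [j1] and [j2] would exhibit it as reducible if no position in between
       separated them. *)
    apply: contrapT => H; apply: nr.
    have lt1 : (j1 < size (take j2 w))%N by rewrite size_take ltn_ord.
    exists (take j1 (take j2 w)), (nth y0 w j1).1, (nth y0 w j1).2,
      (drop j1.+1 (take j2 w)), (nth y0 w j2).2, (drop j2.+1 w); split.
      rewrite {2}ij -!surjective_pairing -drop_nth //.
      rewrite -[nth y0 w j1](@nth_take j2) // -cat_cons catA -drop_nth //.
      by rewrite cat_take_drop cat_take_drop.
    apply/(all_nthP y0) => i.
    rewrite size_drop size_take ltn_ord ltn_subRL => lti.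
    rewrite nth_drop nth_take //; apply: contrapT => /negP ne.
    have lt3 : (j1.+1 + i < size w)%N by apply: ltn_trans lti _.
    apply: H; exists (Ordinal lt3); split=> //=.
    by rewrite addSn ltnS leq_addr.
  + by move=> j; exact: gen_subalg_horner.
  + move=> j; have /eqP /= h := allP wc _ (mem_nth y0 (ltn_ord j)).
    by rewrite -[RHS]h; exact: law_of_same (xa _).
Qed.


Lemma law_of_X a : normalized a -> law_of a 'X = 0.
Proof. by case=> _ a0 _; rewrite /law_of horner_algX. Qed.

Lemma law_of_XX a : normalized a -> law_of a ('X * 'X) = 1.
Proof. by case=> _ _ a2; rewrite /law_of rmorphM /= horner_algX -expr2. Qed.

(* The factors of [b_k^(J)], or of its adjoint, from left to right. *)
Definition row_labels (L : nat) (t : bool) (J : nzset L) : seq 'I_L :=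
  if t then rev (enum (val J)) else enum (val J).

Definition letters (L n p : nat) (J : 'I_p -> nzset L) (alpha : 'I_p -> bool)
    (k : 'I_p -> 'I_n) : seq ('I_n * 'I_L) :=
  flatten [seq [seq (k r, l) | l <- row_labels (alpha r) (J r)] | r <- enum 'I_p].

(** The letters are self-adjoint and the normalization is real, so taking the adjoint of a factor
    only reverses the order of its letters. *)
Lemma joint_moment_expansion (L n p : nat) (x : 'I_n -> 'I_L -> A)
    (J : 'I_p -> nzset L) (alpha : 'I_p -> bool) :
  (forall k l, adj (x k l) = x k l) ->
  joint_moment (grid_sum x) J alpha =
    ((Num.sqrt (n%:R : R))^-1 ^+ p)%:C *
    \sum_(k : {ffun 'I_p -> 'I_n})
      tau A (eval_word (fun v => x v.1 v.2) [seq (v, 'X) | v <- letters J alpha k]).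
Proof.
move=> xsa; rewrite /joint_moment; set c := (Num.sqrt _)^-1.
have step r : adj_pow (alpha r) (grid_sum x (J r)) =
    c%:C *: \sum_(k < n) \prod_(l <- row_labels (alpha r) (J r)) x k l.
  rewrite /grid_sum /adj_pow /row_labels; case: (alpha r).
    rewrite nc_adjZ adj_sum; congr (_ *: _); first by apply/CrealP; rewrite complex_real.
    apply: eq_bigr => k _.
    have <- : \prod_(l <- enum (val (J r))) x k l =
      \prod_(l < L | l \in val (J r)) x k l by rewrite prod_enum.
    rewrite adj_prod.
    by apply: eq_bigr => l _.
  by congr (_ *: _); apply: eq_bigr => k _; rewrite prod_enum.
rewrite (eq_bigr _ (fun r _ => step r)) scaler_prod.
rewrite prodr_const card_ord bigA_distr_bigA linearZ linear_sum /=.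
congr (_ * _); first by rewrite rmorphXn.
apply: eq_bigr => k _; congr (tau A _).
rewrite /eval_word /letters big_map big_flatten big_map prod_enum /=.
apply: eq_bigr => r _; rewrite big_map; apply: eq_bigr => l _.
by rewrite horner_algX.
Qed.

End Expansion.

(** * Letters and kernels *)

Section Letters.
Context {L p : nat}.
Variables (J : 'I_p -> nzset L) (alpha : 'I_p -> bool).

Lemma mem_row_labels t (I : nzset L) l : (l \in row_labels t I) = (l \in val I).
Proof. by rewrite /row_labels; case: t; rewrite ?mem_rev mem_enum. Qed.

Lemma row_labels_uniq t (I : nzset L) : uniq (row_labels t I).
Proof. by rewrite /row_labels; case: t; rewrite ?rev_uniq enum_uniq. Qed.

(** The places of the word before a value of [k] is substituted; [letters] is an image of this list
    for every [k]. *)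
Definition positions : seq ('I_p * 'I_L) :=
  flatten [seq [seq (r, l) | l <- row_labels (alpha r) (J r)] | r <- enum 'I_p].

Lemma lettersE n (k : 'I_p -> 'I_n) :
  letters J alpha k = [seq (k y.1, y.2) | y <- positions].
Proof.
rewrite /positions map_flatten -map_comp; congr flatten.
by apply: eq_map => r /=; rewrite -map_comp.
Qed.

Lemma mem_positions y : (y \in positions) = (y.2 \in val (J y.1)).
Proof.
apply/flatten_mapP/idP => [[r _ /mapP[l]]|yJ].
  by rewrite mem_row_labels => lJ ->.
exists y.1; first by rewrite mem_enum.
by apply/mapP; exists y.2; rewrite ?mem_row_labels // -surjective_pairing.
Qed.

(** The order in which places are read: inside a factor with exponent [*] the indices decrease. *)
Definition before (y z : 'I_p * 'I_L) : bool :=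
  (y.1 < z.1)%N ||
  (y.1 == z.1) && (if alpha y.1 then (z.2 < y.2)%N else (y.2 < z.2)%N).

Lemma before_trans : transitive before.
Proof.
move=> [r l] [r' l'] [r'' l'']; rewrite /before /=.
case/orP=> [h1|/andP[/eqP<- h1]]; case/orP=> [h2|/andP[/eqP<- h2]].
- by rewrite (ltn_trans h1 h2).
- by rewrite h1.
- by rewrite h2.
- rewrite eqxx /= orbC; case: (alpha r') h1 h2 => h1 h2.
    by rewrite (ltn_trans h2 h1).
  by rewrite (ltn_trans h1 h2).
Qed.

Lemma before_irr : irreflexive before.
Proof. by move=> [r l]; rewrite /before /= ltnn eqxx; case: ifP; rewrite ltnn. Qed.

Lemma sorted_enum_ord m (D : {set 'I_m}) :
  sorted (fun i j : 'I_m => (i < j)%N) (enum D).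
Proof.
rewrite /enum_mem; apply: sorted_filter; first by move=> i j k; apply: ltn_trans.
by have := iota_ltn_sorted 0 m; rewrite -val_enum_ord sorted_map enumT.
Qed.

Lemma positions_sorted : sorted before positions.
Proof.
apply: pairwise_sorted; rewrite /positions.
have : pairwise (fun i j : 'I_p => (i < j)%N) (enum 'I_p).
  rewrite -sorted_pairwise; last by move=> i j k; apply: ltn_trans.
  by have := sorted_enum_ord [set: 'I_p]; rewrite (eq_enum (fun i => finset.in_setT i)).
elim: (enum 'I_p) => //= r s IH /andP[rs /IH {}IH].
rewrite pairwise_cat IH andbT; apply/andP; split.
  apply/allrelP => y z /mapP[l _ ->] /flatten_mapP[r' r's /mapP[l' _ ->]].
  by rewrite /before /= (allP rs).
rewrite pairwise_map -sorted_pairwise; last first.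
  by move=> l1 l2 l3; exact: before_trans.
have E : (fun l l' => before (r, l) (r, l')) =2
   (fun l l' : 'I_L => if alpha r then (l' < l)%N else (l < l')%N).
  by move=> l l'; rewrite /before /= ltnn eqxx.
rewrite (eq_sorted E) /row_labels; case: (alpha r).
  by rewrite rev_sorted sorted_enum_ord.
exact: sorted_enum_ord.
Qed.

(** As [positions] is strictly sorted, subsequences of the word come from increasing lists of
    places. This turns crossing patterns into inequalities between places. *)
Lemma subseq_lettersP n (k : 'I_p -> 'I_n) (s : seq ('I_n * 'I_L)) :
  reflect (exists t, [/\ all (mem positions) t, sorted before t
                       & s = [seq (k y.1, y.2) | y <- t]])
          (subseq s (letters J alpha k)).
Proof.
rewrite lettersE; apply: (iffP idP) => [/subseqP[m _ ->]|[t [tp ts ->]]].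
  exists (mask m positions); rewrite map_mask; split=> //.
    by apply/allP => y /mem_mask.
  by apply: (subseq_sorted before_trans (mask_subseq _ _) positions_sorted).
apply: map_subseq.
suff -> : t = seq.filter (mem t) positions by exact: filter_subseq.
apply: (irr_sorted_eq before_trans before_irr) => //.
  exact: (sorted_filter before_trans _ positions_sorted).
move=> y; rewrite mem_filter; case yt: (y \in t) => /=; last by rewrite /= yt.
by rewrite /= yt; apply/esym/(allP tp).
Qed.

Lemma count_letters n (k : 'I_p -> 'I_n) i l :
  count_mem (i, l) (letters J alpha k) =
  #|[set r | (k r == i) && (l \in val (J r))]|.
Proof.
rewrite /letters count_flatten -map_comp sumnE big_map big_enum /= cardE.
rewrite -sum1_size big_enum /= [RHS]big_mkcond /=; apply: eq_bigr => r _.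
rewrite finset.inE; have [ki|ki] /= := eqVneq (k r) i; last first.
  apply/eqP; rewrite -leqn0 leqNgt -has_count has_pred1; apply/mapP => -[l' _ [ik _]].
  by rewrite ik eqxx in ki.
rewrite count_map (eq_count (a2 := pred1 l)); last first.
  by move=> l' /=; rewrite xpair_eqE ki eqxx.
by rewrite count_uniq_mem ?row_labels_uniq // mem_row_labels; case: ifP.
Qed.

Definition kernel_partition n (k : 'I_p -> 'I_n) := preim_partition k [set: 'I_p].

Lemma kernel_partition_pblock n (k : 'I_p -> 'I_n) r s :
  (s \in finset.pblock (kernel_partition k) r) = (k r == k s).
Proof.
rewrite (@pblock_equivalence_partition _ (fun x y => k x == k y) [set: 'I_p]) //.
by split=> // /eqP->.
Qed.

Lemma kernel_partition_block n (k : 'I_p -> 'I_n) b :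
  b \in kernel_partition k -> exists r, b = [set s | k r == k s].
Proof.
by case/imsetP => r _ ->; exists r; apply/setP => s; rewrite !finset.inE.
Qed.

(** If no letter occurs exactly once, every fiber of [k] has at least two elements. The fiber sizes
    add up to [p], so either some fiber is larger and the image has fewer than [p]/2 values, or all
    fibers are pairs. *)
Lemma letters_trichotomy n (k : 'I_p -> 'I_n) :
  [\/ exists v, count_mem v (letters J alpha k) = 1%N,
      (#|[set k r | r : 'I_p]|.*2 < p)%N
    | compatible_pair_partition J (kernel_partition k)].
Proof.
have [|nsing] := EM (exists v, count_mem v (letters J alpha k) = 1%N).
  by constructor 1.
pose F i := #|[set r | k r == i]|.
have F2 r : (2 <= F (k r))%N.
  (* On a singleton fiber [{r}], any [l] in the nonempty set [J r] would give a letter occurring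
     once. *)
  rewrite ltnNge; apply/negP => F1; apply: nsing.
  have [l lJ] := finset.set0Pn _ (valP (J r)); exists (k r, l); rewrite count_letters.
  suff -> : [set s | (k s == k r) && (l \in val (J s))] = [set r] by rewrite cards1.
  have /cards1P[t Ft] : #|[set s | k s == k r]| == 1%N.
    rewrite eqn_leq F1 /= card_gt0; apply/finset.set0Pn; exists r.
    by rewrite finset.inE.
  have rt : r = t by apply/set1P; rewrite -Ft finset.inE.
  apply/setP => s; rewrite !finset.inE; have := finset.in_set (fun s => k s == k r) s.
  rewrite Ft finset.inE -rt => <-; case: eqP => // -> /=; exact: lJ.
have sumF : (\sum_(i in [set k r | r : 'I_p]) F i = p)%N.
  rewrite -[RHS]card_ord -[RHS]sum1_card.
  rewrite (partition_big k (mem [set k r | r : 'I_p])) /=; last first.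
    by move=> r _; apply/imsetP; exists r.
  apply: eq_bigr => i _; rewrite /F -sum1_card; apply: eq_bigl => r.
  by rewrite finset.inE.
have [allF2|/forallPn[r Fr]] := boolP [forall r, F (k r) == 2%N]; last first.
  constructor 2; rewrite -[leqRHS]sumF (bigD1 (k r)) /=; last by apply/imsetP; exists r.
  rewrite (cardsD1 (k r)).
  have -> : k r \in [set k s | s : 'I_p] by apply/imsetP; exists r.
  rewrite doubleD /= -addSn leq_add //.
    by rewrite ltn_neqAle eq_sym Fr F2.
  rewrite -muln2 -sum_nat_const.
  rewrite (eq_bigl (fun i => (i \in [set k r | r : 'I_p]) && (i != k r))).
    by apply: leq_sum => i /andP[/imsetP[s _ ->] _].
  by move=> i; rewrite !finset.inE andbC.
constructor 3; apply/andP; split.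
  apply/andP; split; first exact: preim_partitionP.
  apply/forall_inP => b /kernel_partition_block[r ->].
  rewrite -(eqP (forallP allF2 r)) /F; apply/eqP; apply: eq_card => s.
  by rewrite !finset.inE eq_sym.
apply/forall_inP => b /kernel_partition_block[q ->].
apply/forall_inP => r; rewrite finset.inE => /eqP kr.
apply/forall_inP => s; rewrite finset.inE => /eqP ks.
(* By symmetry one inclusion of labels suffices: an [l] in only one label of a two-element fiber
   would give a letter occurring once. *)
suff wlog_ r' s' : k q = k r' -> k q = k s' -> val (J r') \subset val (J s').
  by apply/eqP/val_inj/eqP; rewrite finset.eqEsubset !wlog_.
move=> {r s kr ks} kr ks; apply/fintype.subsetP => l lr; apply: contraT => ls.
exfalso; apply: nsing; exists (k q, l); rewrite count_letters.
apply/eqP/cards1P; exists r'; apply/eqP; rewrite eq_sym.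
have rs : r' != s' by apply: contraNneq ls => <-.
have /eqP Fq := forallP allF2 q.
have : [set r'; s'] == [set r | k r == k q].
  rewrite eqEcard -/(F (k q)) Fq cards2 rs andbT; apply/fintype.subsetP => t.
  by rewrite !finset.inE => /orP[]/eqP->; rewrite -?kr -?ks.
move/eqP => /setP E; apply/eqP/setP => t; have := E t; rewrite !finset.inE => <-.
have [->|tr] := eqVneq t r'; first by rewrite lr.
by case: eqVneq => //= ->; rewrite (negbTE ls).
Qed.

End Letters.

(** * Words attached to pair partitions *)

Section Pairing.
Context {L p : nat}.
Variables (J : 'I_p -> nzset L) (alpha : 'I_p -> bool) (pi : {set {set 'I_p}}).
Hypothesis cpi : compatible_pair_partition J pi.

Let pi_part : finset.partition pi [set: 'I_p].
Proof. by case/andP: cpi => /andP[]. Qed.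

Let pi_pair b : b \in pi -> #|b| = 2%N.
Proof. by case/andP: cpi => /andP[_ /forall_inP H] _ /H/eqP. Qed.

Let pi_label b r s : b \in pi -> r \in b -> s \in b -> J r = J s.
Proof.
by case/andP: cpi => _ /forall_inP H /H/forall_inP{}H /H/forall_inP{}H /H/eqP.
Qed.

Let mem_cover_pi r : r \in finset.cover pi.
Proof. by rewrite (finset.cover_partition pi_part) finset.in_setT. Qed.

Let pi_triv : finset.trivIset pi.
Proof. by case/and3P: pi_part. Qed.

Definition block_of (r : 'I_p) : block pi :=
  exist _ (finset.pblock pi r) (finset.pblock_mem (mem_cover_pi r)).

Lemma block_ofE (u : block pi) r : (r \in val u) = (block_of r == u).
Proof.
apply/idP/eqP => [ru|<-]; last by rewrite /= finset.mem_pblock.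
by apply: val_inj; exact: (finset.def_pblock pi_triv (valP u) ru).
Qed.

Lemma block_of_surj (u : block pi) : exists r, block_of r = u.
Proof.
have /card_gt0P[r ru] : (0 < #|val u|)%N by rewrite (pi_pair (valP u)).
by exists r; apply/eqP; rewrite -block_ofE.
Qed.

Lemma eq_block_of_label r s : block_of r = block_of s -> J r = J s.
Proof.
move=> E; apply: (pi_label (valP (block_of r))); first by rewrite block_ofE.
by rewrite block_ofE E.
Qed.

Lemma block_label_of r : block_label J (block_of r) = val (J r).
Proof.
rewrite /block_label; case: pickP => [s|/(_ r)]; last by rewrite block_ofE eqxx.
by rewrite block_ofE => /eqP/eq_block_of_label->.
Qed.

Lemma block_of_same3 r s t : block_of r = block_of t -> block_of s = block_of t ->
  r != s -> (t == r) || (t == s).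
Proof.
move=> rt st rs; have /eqP/setP : [set r; s] == val (block_of t).
  rewrite eqEcard (pi_pair (valP (block_of t))) cards2 rs andbT.
  by apply/fintype.subsetP => q; rewrite finset.inE !finset.inE block_ofE
    => /orP[]/eqP->; apply/eqP.
by move=> /(_ t); rewrite block_ofE eqxx !finset.inE.
Qed.

Lemma same_exponent_of r s : block_of r = block_of s -> r != s ->
  same_exponent alpha (block_of r) = (alpha r == alpha s).
Proof.
move=> rs nrs; apply/idP/idP.
  by move=> /forall_inP/(_ r); rewrite block_ofE eqxx => /(_ isT)/forall_inP;
    apply; rewrite block_ofE rs.
move=> /eqP ars; apply/forall_inP => q; rewrite block_ofE => /eqP rq.
apply/forall_inP => t; rewrite block_ofE => /eqP rt.
have /orP q2 := block_of_same3 (esym rq) (etrans (esym rs) (esym rq)) nrs.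
have /orP t2 := block_of_same3 (esym rt) (etrans (esym rs) (esym rt)) nrs.
by case: q2 => /eqP->; case: t2 => /eqP->; rewrite ?ars.
Qed.

(** A map with kernel [pi] is constant on blocks and separates them, so it factors through
    [block_of] by a unique injection. *)
Lemma sum_kernel (M : nmodType) n (F : {ffun 'I_p -> 'I_n} -> M) :
  \sum_(k : {ffun 'I_p -> 'I_n} | kernel_partition k == pi) F k =
  \sum_(kappa : {ffun block pi -> 'I_n} | injectiveb kappa)
     F [ffun r => kappa (block_of r)].
Proof.
have /choice[rep repK] := block_of_surj.
have kerP (k : {ffun 'I_p -> 'I_n}) :
    reflect (forall r s, (k r == k s) = (block_of r == block_of s))
    (kernel_partition k == pi).
  apply: (iffP eqP) => [E r s|H].
    by rewrite -kernel_partition_pblock E -[finset.pblock _ _]/(val (block_of r))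
      block_ofE eq_sym.
  rewrite -[RHS](finset.preim_partition_pblock pi_part).
  by apply: eq_imset => r; apply/setP => s; rewrite !finset.inE H -val_eqE.
rewrite (reindex_onto (fun kappa : {ffun block pi -> 'I_n} =>
    [ffun r => kappa (block_of r)]) (fun k => [ffun u => k (rep u)])) /=; last first.
  move=> k /kerP H; apply/ffunP => r; rewrite !ffunE; apply/eqP.
  by rewrite H repK.
apply: eq_bigl => kappa.
have -> : [ffun u => [ffun r => kappa (block_of r)] (rep u)] == kappa.
  by apply/eqP/ffunP => u; rewrite !ffunE repK.
rewrite andbT; apply/kerP/injectiveP => [H u v kuv|inj r s].
  apply/eqP; rewrite -(repK u) -(repK v) -H !ffunE !repK; exact/eqP.
by rewrite !ffunE (inj_eq inj).
Qed.

Context {n : nat}.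
Variable g : sgraph ('I_n * 'I_L)%type.

Definition joined (i j : 'I_n) (I1 I2 : {set 'I_L}) : bool :=
  [forall l1 in I1, forall l2 in I2, edge g (i, l1) (j, l2)].

Definition clique (i : 'I_n) (I : {set 'I_L}) : bool :=
  [forall l1 in I, forall l2 in I, (l1 != l2) ==> edge g (i, l1) (i, l2)].

(** The first half corresponds to the edges of the intersection graph, the second to the edges
    towards xi in [extended_graph]. *)
Definition labels_adjacent (kappa : block pi -> 'I_n) : bool :=
  [forall u, forall v, crossing (val u) (val v) ==>
      joined (kappa u) (kappa v) (block_label J u) (block_label J v)] &&
  [forall u, same_exponent alpha u ==> clique (kappa u) (block_label J u)].

Section Injective.
Variables (kappa : block pi -> 'I_n) (kappa_inj : injective kappa).
Let k (r : 'I_p) := kappa (block_of r).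

Lemma count_letters_pairing v : v \in letters J alpha k ->
  count_mem v (letters J alpha k) = 2%N.
Proof.
rewrite lettersE => /mapP[[r l]]; rewrite mem_positions /= => lJ ->.
rewrite -lettersE count_letters -(pi_pair (valP (block_of r))); apply: eq_card => s.
rewrite finset.inE block_ofE (inj_eq kappa_inj).
by case: eqP => //= /eq_block_of_label->.
Qed.

(** A pattern [u v u v] in the word arises in two ways: from two crossing blocks, or from two
    letters of a single block read in the same order in both its factors. The latter happens exactly
    when the two exponents agree, whence the clique condition. *)
Lemma crossings_adjacent_letters :
  crossings_adjacent (edge g) (letters J alpha k) <-> labels_adjacent kappa.
Proof.
split=> [adj|/andP[/forallP adj1 /forallP adj2]]; last first.
  move=> u v uv /subseq_lettersP[t [tp ts E]].
  have := congr1 size E; rewrite size_map.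
  case: t tp ts E => [|[r1 l1] [|[r2 l2] [|[s1 l3] [|[s2 l4] [|? ?]]]]] //=.
  move=> /and5P[]; rewrite !mem_positions /= => p1 p2 _ _ _ /and4P[b12 b23 b34 _].
  move=> E _; case: E uv => -> -> [/kappa_inj E1 l13] [/kappa_inj E2 l24] uv.
  move: b23 b34; rewrite -{}l13 -{}l24 => b23 b34.
  have lt1 : (r1 < s1)%N.
    by have := before_trans b12 b23; rewrite /before /= !ltnn if_same andbF orbF.
  have lt2 : (r2 < s2)%N.
    by have := before_trans b23 b34; rewrite /before /= !ltnn if_same andbF orbF.
  (* In the single-block case the inequalities force [r2 = r1] and [s2 = s1]; then [l1] precedes
     [l2] in both factors, so the exponents are equal. *)
  have [E12|N12] := eqVneq (block_of r1) (block_of r2).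
    have n1 : r1 != s1 by rewrite -val_eqE neq_ltn lt1.
    have /orP h2 := block_of_same3 E12 (etrans (esym E1) E12) n1.
    have /orP h4 := block_of_same3 (etrans E12 E2) (etrans (esym E1) (etrans E12 E2)) n1.
    have [r21 s21] : r2 = r1 /\ s2 = s1.
      by case: h2 h4 => /eqP r2E [] /eqP s2E; move: lt2; rewrite r2E s2E ?ltnn //;
        move/(ltn_trans lt1); rewrite ltnn.
    rewrite r21 s21 {r21 s21 h2 h4 lt2 E12 E2} in uv p2 b12 b23 b34 *.
    have l12 : l1 != l2 by apply: contra uv => /eqP->.
    have := adj2 (block_of r1); rewrite (same_exponent_of E1 n1) block_label_of.
    have -> /= : alpha r1 == alpha s1.
      move: b12 b34; rewrite /before /= !ltnn !eqxx /=.
      by case: (alpha r1) (alpha s1) => [] [] // h1 /(ltn_trans h1); rewrite ltnn.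
    by move=> /forall_inP/(_ _ p1)/forall_inP/(_ _ p2); rewrite l12.
  have lt12 : (r1 < r2)%N.
    by case/orP: b12 => //= /andP[/eqP E _]; rewrite E eqxx in N12.
  have lt23 : (r2 < s1)%N.
    by case/orP: b23 => //= /andP[/eqP E _]; rewrite E E1 eqxx in N12.
  have lt34 : (s1 < s2)%N.
    by case/orP: b34 => //= /andP[/eqP E _]; rewrite E1 E2 E eqxx in N12.
  have /forallP/(_ (block_of r2))/implyP := adj1 (block_of r1).
  have -> : crossing (val (block_of r1)) (val (block_of r2)).
    rewrite /crossing val_eqE N12 andTb; apply/orP; left.
    apply/exists_inP; exists r1; first by rewrite block_ofE.
    apply/exists_inP; exists r2; first by rewrite block_ofE.
    apply/exists_inP; exists s1; first by rewrite block_ofE E1.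
    apply/exists_inP; exists s2; first by rewrite block_ofE E2.
    by rewrite lt12 lt23 lt34.
  move=> /(_ isT); rewrite !block_label_of => /forall_inP/(_ _ p1)/forall_inP.
  exact.
apply/andP; split.
  apply/forallP => u; apply/forallP => v; apply/implyP => /andP[uv cr].
  have wlog_ u' v' : u' != v' -> interlaced (val u') (val v') ->
      joined (kappa u') (kappa v') (block_label J u') (block_label J v').
    move=> {}uv /exists_inP[r1 r1u /exists_inP[r2 r2v /exists_inP[s1 s1u
      /exists_inP[s2 s2v /andP[/andP[r12 r2s] s12]]]]].
    rewrite !block_ofE in r1u r2v s1u s2v.
    apply/forall_inP => l1 l1u; apply/forall_inP => l2 l2v.
    move: l1u l2v uv; rewrite -(eqP r1u) -(eqP r2v) !block_label_of => l1J l2J uv.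
    apply: adj.
      by apply: contra uv => /eqP[/kappa_inj/(congr1 val)/val_inj->].
    apply/subseq_lettersP; exists [:: (r1, l1); (r2, l2); (s1, l1); (s2, l2)].
    rewrite /= !mem_positions /= l1J l2J /before /= r12 r2s s12 /=.
    have [E1 E2] : block_of s1 = block_of r1 /\ block_of s2 = block_of r2.
      by rewrite (eqP r1u) (eqP r2v) (eqP s1u) (eqP s2v).
    rewrite (eq_block_of_label E1) (eq_block_of_label E2) l1J l2J; split=> //.
    by rewrite /k E1 E2.
  case/orP: cr => cr; first exact: wlog_.
  have /forall_inP H := wlog_ v u (contra_neq esym uv) cr.
  apply/forall_inP => l1 l1u; apply/forall_inP => l2 l2v; rewrite edge_sym.
  by have /forall_inP := H l2 l2v; apply.
apply/forallP => u; apply/implyP => su.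
apply/forall_inP => l1 l1u; apply/forall_inP => l2 l2u; apply/implyP => l12.
have [r ru] := block_of_surj u; subst u.
have [s rs nrs] : exists2 s, block_of r = block_of s & r != s.
  have : (#|val (block_of r) :\ r|).+1 = 2%N.
    by rewrite -(pi_pair (valP (block_of r))) [RHS](cardsD1 r) block_ofE eqxx.
  case=> /eqP/cards1P[s E]; have := finset.set11 s.
  rewrite -E finset.in_setD1 -[finset.pblock pi r]/(val (block_of r)) block_ofE.
  by rewrite eq_sym => /andP[rs /eqP sr]; exists s.
rewrite block_label_of in l1u l2u.
rewrite (same_exponent_of rs nrs) in su.
wlog rs_lt : r s rs nrs su l1u l2u / (r < s)%N.
  move=> H; have [|sr|/val_inj E] := ltngtP r s; last by rewrite E eqxx in nrs.
    exact: H rs nrs su l1u l2u.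
  rewrite rs; apply: (H s r); rewrite 1?eq_sym ?(eq_block_of_label (esym rs)) //.
wlog l12b : l1 l2 l12 l1u l2u / before alpha (r, l1) (r, l2).
  move=> H; case b12: (before alpha (r, l1) (r, l2)); first exact: H b12.
  rewrite edge_sym; apply: H => //; first by rewrite eq_sym.
  move: b12 l12; rewrite /before /= ltnn eqxx /= -val_eqE /=; case: (alpha r); lia.
rewrite -/(k r); apply: adj; first by rewrite xpair_eqE eqxx.
(* With equal exponents the factors [r] and [s] list [l1] and [l2] in the same order, which makes
   these four places increasing. *)
apply/subseq_lettersP; exists [:: (r, l1); (r, l2); (s, l1); (s, l2)].
rewrite /= !mem_positions /= -(eq_block_of_label rs) l1u l2u l12b; split=> //.
  rewrite {1}/before /= rs_lt /=; move: l12b; rewrite /before /= !ltnn !eqxx /=.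
  by rewrite (eqP su) andbT.
by rewrite /k -rs.
Qed.

End Injective.

End Pairing.

(** * Integrals of step functions *)

(** A map with at most [m] values factors through ['I_m]: list the values, padded with [ord0], and
    send each point to the index of its value. *)
Lemma card_small_image (V : finType) (n m : nat) :
  (#|[set k : {ffun V -> 'I_n.+1} | #|k @: [set: V]| <= m]|
     <= n.+1 ^ m * m ^ #|V|)%N.
Proof.
pose Phi (fh : {ffun 'I_m -> 'I_n.+1} * {ffun V -> 'I_m}) : {ffun V -> 'I_n.+1} :=
  [ffun v => fh.1 (fh.2 v)].
have -> : (n.+1 ^ m * m ^ #|V| = #|[set: {ffun 'I_m -> 'I_n.+1} * {ffun V -> 'I_m}]|)%N.
  by rewrite finset.cardsT card_prod !card_ffun !card_ord.
apply: leq_trans (leq_imset_card Phi _); apply: subset_leq_card.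
apply/fintype.subsetP => k; rewrite finset.inE => km; apply/imsetP.
have lt v : (index (k v) (enum (k @: [set: V])) < m)%N.
  by apply: leq_trans km; rewrite cardE index_mem mem_enum imset_f.
exists ([ffun j : 'I_m => nth ord0 (enum (k @: [set: V])) j],
        [ffun v => Ordinal (lt v)]) => //.
by apply/ffunP => v; rewrite !ffunE /= nth_index // mem_enum imset_f.
Qed.

Section StepIntegral.
Local Open Scope classical_set_scope.
Context {R : realType}.
Variable n : nat.
Notation mu := (@lebesgue_measure R).

Let block_itv (i : 'I_n.+1) : set R := `[i%:R / n.+1%:R, i.+1%:R / n.+1%:R[.

Lemma Rintegral_step_sum (I : eqType) (s : seq I) (E : I -> set R) (c : I -> R)
    (D : set R) :
  measurable D -> (mu D < +oo)%E -> (forall i, measurable (E i)) ->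
  let f x := \sum_(i <- s) c i * \1_(E i) x in
  mu.-integrable D (EFin \o f) /\
  \int[mu]_(x in D) f x = \sum_(i <- s) c i * fine (mu (E i `&` D)).
Proof.
move=> mD Dfin mE /=; have mD' : measurable (D : set (measurableTypeR R)) := mD.
have i1 i : mu.-integrable D (EFin \o (\1_(E i) : R -> R)).
  apply: measurable_bounded_integrable => //; first exact: measurable_indic (mE i).
  rewrite /bounded_near; exists 1; split=> // M M1 x _ /=; apply: le_trans (ltW M1).
  by rewrite indicE; case: (_ \in _); rewrite /= ?normr1 ?normr0.
elim: s => [|i s [IH1 IH2]].
  rewrite (_ : (fun x => _) = fun=> 0); last by apply/funext => x; rewrite big_nil.
  split.
    apply: measurable_bounded_integrable => //.
    by rewrite /bounded_near; exists 0; split=> // M M0 x _ /=; rewrite normr0 ltW.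
  by rewrite big_nil Rintegral_cst // mul0r.
have ic : mu.-integrable D (EFin \o (fun x => c i * \1_(E i) x)).
  by apply: (eq_integrable mD' _ _ _ (integrableZl mD' (c i) (i1 i))) => x _.
rewrite (_ : (fun x => _) = fun x => c i * \1_(E i) x + \sum_(j <- s) c j * \1_(E j) x);
  last by apply/funext => x; rewrite big_cons.
split; first by apply: (eq_integrable mD' _ _ _ (integrableD mD' ic IH1)) => x _.
rewrite RintegralD // IH2 big_cons RintegralZl //; congr (_ * _ + _).
by congr fine; exact: (integral_indic _ mD' (mE i)).
Qed.

Lemma in_block_inj (x : R) (i j : 'I_n.+1) : in_block i x -> in_block j x -> i = j.
Proof.
rewrite /in_block => /andP[i1 i2] /andP[j1 j2].
have := le_lt_trans i1 j2; have := le_lt_trans j1 i2.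
rewrite !ltr_pM2r ?invr_gt0 ?ltr0n // !ltr_nat !ltnS => ji ij.
by apply/val_inj/eqP; rewrite eqn_leq ij ji.
Qed.

Lemma in_block_ex (x : R) : 0 <= x < 1 -> exists i : 'I_n.+1, in_block i x.
Proof.
move=> /andP[x0 x1]; have nx : 0 <= x * n.+1%:R by rewrite mulr_ge0.
have /andP[t1 t2] := Num.Theory.truncn_itv nx.
have lt : (Num.truncn (x * n.+1%:R) < n.+1)%N.
  by rewrite -(ltr_nat R); apply: le_lt_trans t1 _; rewrite gtr_pMl ?ltr0n.
exists (Ordinal lt); rewrite /in_block /= ler_pdivrMr ?ltr0n // t1.
by rewrite ltr_pdivlMr ?ltr0n.
Qed.

Lemma Rintegral_step (f : R -> R) (c : 'I_n.+1 -> R) :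
  (forall i x, in_block i x -> f x = c i) ->
  \int[mu]_(x in [set` `[0, 1]%R]) f x = n.+1%:R^-1 * \sum_i c i.
Proof.
move=> fc.
have fE : {in `[0, 1[%classic, (fun x => \sum_(i <- enum 'I_n.+1)
      c i * \1_(block_itv i) x) =1 f}.
  move=> x /set_mem /=; rewrite ?in_itv /= => /in_block_ex[i xi].
  rewrite (fc _ _ xi) big_enum (bigD1 i) //= big1 ?addr0 => [|j ji].
    by rewrite indicE mem_set ?mulr1 //= ?in_itv.
  rewrite indicE memNset ?mulr0 //= => xj; rewrite ?in_itv /= in xj.
  by rewrite (in_block_inj xj xi) eqxx in ji.
have m01 : measurable (`[0, 1[%classic : set R) by exact: measurable_itv.
have f01 : (mu (`[0%R, 1%R[%classic : set R) < +oo)%E.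
  by rewrite lebesgue_measure_itv /= lte_fin ltr01 sube0 ltry.
have m01' : measurable (`[0, 1[%classic : set (measurableTypeR R)) := m01.
have [int Eint] := @Rintegral_step_sum _ (enum 'I_n.+1) (fun i => block_itv i) c
  _ m01 f01 (fun i => measurable_itv _).
(* The endpoint 1 lies in no block, so it is discarded before [f] is replaced by a step function. *)
rewrite -Rintegral_itv_bndo_bndc; last first.
  by apply: (eq_integrable m01' _ _ _ int) => x x01; rewrite /= fE.
transitivity (\int[mu]_(x in `[0%R, 1%R[%classic)
    (\sum_(i <- enum 'I_n.+1) c i * \1_(block_itv i) x)).
  by apply: eq_Rintegral => x x01; rewrite fE.
rewrite Eint big_enum mulr_sumr; apply: eq_bigr => i _.
rewrite mulrC; congr (_ * _).
rewrite setIidl.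
  rewrite lebesgue_measure_itv /= lte_fin ltr_pM2r ?invr_gt0 ?ltr0n //.
  by rewrite ltr_nat leqnn -EFinB /= -mulrBl -natrB // subSnn mul1r.
move=> x; rewrite /block_itv /= !in_itv /= => /andP[x1 x2]; apply/andP; split.
  by apply: le_trans x1; rewrite divr_ge0.
by apply: lt_le_trans x2 _; rewrite ler_pdivrMr ?ltr0n // mul1r ler_nat.
Qed.

End StepIntegral.

(** * Densities in the step graphon of a grid graph *)

Section StepRho.
Context {R : realType} {n : nat}.

Lemma cube_integral_step (V : finType) (f : (V -> R) -> R)
    (h : (V -> 'I_n.+1) -> R) :
  (forall x kappa, (forall v, in_block (kappa v) (x v)) -> f x = h kappa) ->
  cube_integral f =
    n.+1%:R^-1 ^+ #|V| * \sum_(kappa : {ffun V -> 'I_n.+1}) h kappa.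
Proof.
move=> fh; pose upd (kappa : V -> 'I_n.+1) v i u := if u == v then i else kappa u.
(* Induction over the coordinates still to be integrated: those outside [s] are frozen in the blocks
   given by [kappa], and the sum runs over the assignments agreeing with [kappa] there. *)
have step s x kappa : uniq s -> (forall v, in_block (kappa v) (x v)) ->
    cube_integral_seq s f x = n.+1%:R^-1 ^+ size s *
      \sum_(k : {ffun V -> 'I_n.+1} | [forall u, (u \notin s) ==> (k u == kappa u)]) h k.
  elim: s x kappa => [|v s IH] x kappa /=.
    move=> _ xk; rewrite expr0 mul1r (big_pred1 (finfun kappa)) => [|k].
      by rewrite (fh _ _ xk); congr h; apply/funext => v; rewrite ffunE.
    apply/forallP/eqP => [H|-> u]; last by rewrite ffunE eqxx ?implybT.
    by apply/ffunP => u; rewrite ffunE; apply/eqP; have := H u.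
  move=> /andP[vs us] xk.
  rewrite (@Rintegral_step R n _ (fun i => n.+1%:R^-1 ^+ size s *
      \sum_(k : {ffun V -> 'I_n.+1} |
         [forall u, (u \notin s) ==> (k u == upd kappa v i u)]) h k)); last first.
    move=> i t ti; apply: IH => // u; rewrite /upd; case: eqP => // _; exact: xk.
  rewrite -mulr_sumr mulrA -exprS; congr (_ * _).
  rewrite [RHS](partition_big (fun k : {ffun V -> 'I_n.+1} => k v) xpredT) //=.
  apply: eq_bigr => i _; apply: eq_bigl => k; rewrite /upd.
  apply/forallP/andP => [H|[/forallP H /eqP kv] u].
    split; last by have := H v; rewrite vs eqxx.
    apply/forallP => u; have := H u; rewrite inE negb_or.
    by case: (eqVneq u v) => //=; rewrite ?implybT.
  have := H u; rewrite inE negb_or; case: (eqVneq u v) => [->|] //=.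
  by rewrite kv eqxx ?implybT.
have in0 : in_block (ord0 : 'I_n.+1) (0 : R).
  by rewrite /in_block mul0r lexx divr_gt0.
rewrite /cube_integral (step _ _ (fun=> ord0)) ?enum_uniq // -cardE.
congr (_ * _); apply: eq_bigl => k; apply/forallP => u.
by rewrite mem_enum.
Qed.

Lemma graphon_of_block (L : nat) (G : dgraph R L 'I_n.+1) i j x y :
  in_block i x -> in_block j y ->
  graphon_of G x y = if edge G i j then dg_dec G i j else dec_zero.
Proof.
move=> xi yj; rewrite /graphon_of; case: pickP => [[i' j'] /and3P[/= h1 h2 e]|H].
  by rewrite -(in_block_inj h1 xi) -(in_block_inj h2 yj) e.
by have := H (i, j); rewrite /= xi yj /= => ->.
Qed.

Lemma rho_graphon_of (L : nat) (o : orientation) (V : finType) (F : dgraph R L V)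
    (G : dgraph R L 'I_n.+1) :
  rho o F (graphon_of G) = n.+1%:R^-1 ^+ #|V| *
    \sum_(kappa : {ffun V -> 'I_n.+1})
      \prod_(uv : V * V | edge F uv.1 uv.2 && o V F uv.1 uv.2)
        dec_dot (dg_dec F uv.1 uv.2)
          (if edge G (kappa uv.1) (kappa uv.2)
           then dg_dec G (kappa uv.1) (kappa uv.2) else dec_zero).
Proof.
rewrite /rho; apply: (cube_integral_step (h := fun kappa => \prod_(uv : V * V |
  edge F uv.1 uv.2 && o V F uv.1 uv.2) dec_dot (dg_dec F uv.1 uv.2)
          (if edge G (kappa uv.1) (kappa uv.2)
           then dg_dec G (kappa uv.1) (kappa uv.2) else dec_zero))).
by move=> x kappa xk; apply: eq_bigr => uv _; rewrite (graphon_of_block _ (xk _) (xk _)).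
Qed.

Lemma dec_dot_basis (L : nat) I J (T : decoration R L) :
  dec_dot (dec_basis I J) T = T I J.
Proof.
rewrite /dec_dot (bigD1 I) //= (bigD1 J) //= !eqxx mul1r.
rewrite big1 ?addr0 => [|J' /negbTE->]; last by rewrite andbF mul0r.
rewrite big1 ?addr0 // => I' /negbTE-> /=.
by rewrite big1 // => J' _; rewrite mul0r.
Qed.

Lemma prod_indic (I : finType) (P Q : pred I) :
  \prod_(i | P i) ((Q i)%:R : R) = [forall (i | P i), Q i]%:R.
Proof.
have [/forall_inP H|] := boolP [forall (i | P i), Q i].
  by rewrite big1 // => i /H->.
rewrite negb_forall_in => /exists_inP[i Pi Qi].
by rewrite (bigD1 i) //= (negbTE Qi) mul0r.
Qed.

Section Pairing.
Context {L p : nat}.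
Variables (J : 'I_p -> nzset L) (alpha : 'I_p -> bool) (pi : {set {set 'I_p}}).
Hypothesis cpi : compatible_pair_partition J pi.
Variable o : orientation.
Hypothesis o_orients : is_orientation o.
Variable g : sgraph ('I_n.+1 * 'I_L)%type.

Let B : finType := block pi.

Lemma gamma_clique_indic i (I : {set 'I_L}) :
  gamma_clique R g i I = (clique g i I)%:R.
Proof.
rewrite /gamma_clique /clique -prod_indic; apply: eq_bigr => l1 _.
rewrite prod_indic; congr (_%:R); congr nat_of_bool.
by apply: eq_forallb => l2; case: (l2 \in I).
Qed.

Lemma block_label_neq0 (u : B) : block_label J u != finset.set0.
Proof.
have [r <-] := block_of_surj cpi u; rewrite (block_label_of cpi).
exact: (valP (J r)).
Qed.

Let weight (kappa : option B -> 'I_n.+1) : R :=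
  \prod_(uv : option B * option B | extended_edge alpha uv.1 uv.2 &&
      @o (option B) (extended_graph alpha pi) uv.1 uv.2)
    dec_dot (dec_basis (vertex_label J uv.1) (vertex_label J uv.2))
     (if edge (complete_graph 'I_n.+1) (kappa uv.1) (kappa uv.2)
      then Decoration (gamma_entry01 R g (kappa uv.1) (kappa uv.2)) else dec_zero).

Lemma weight01 kappa : 0 <= weight kappa <= 1.
Proof. by apply: prodr01 => uv; rewrite dec_dot_basis entry01. Qed.

Let edge_ok (kappa : option B -> 'I_n.+1) (x y : option B) : bool :=
  match x, y with
  | Some u, Some v => joined g (kappa x) (kappa y) (block_label J u) (block_label J v)
  | Some u, None => clique g (kappa x) (block_label J u)
  | None, Some v => clique g (kappa y) (block_label J v)
  | None, None => true
  end.

Lemma edge_ok_sym kappa x y : edge_ok kappa x y = edge_ok kappa y x.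
Proof.
case: x y => [u|] [v|] //=; apply/forall_inP/forall_inP => H l lu;
  by apply/forall_inP => l' lv; rewrite edge_sym; have /forall_inP := H l' lv; apply.
Qed.

(** Injectivity avoids the diagonal blocks, where the step graphon is zero, so every factor is an
    indicator read off [gamma_entry]. The condition on an edge is symmetric, so testing one
    orientation of each edge tests them all. *)
Lemma weight_inj kappa : injective kappa ->
  weight kappa = (labels_adjacent J alpha g (kappa \o Some))%:R.
Proof.
move=> kinj; rewrite /weight.
under eq_bigr => uv /andP[e _].
  rewrite dec_dot_basis.
  have -> : edge (complete_graph 'I_n.+1) (kappa uv.1) (kappa uv.2).
    rewrite /= (inj_eq kinj); apply: contraTneq e => ->.
    by have /= -> := edge_irr (extended_graph alpha pi) uv.2.
  have -> : Decoration (gamma_entry01 R g (kappa uv.1) (kappa uv.2))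
      (vertex_label J uv.1) (vertex_label J uv.2) = (edge_ok kappa uv.1 uv.2)%:R.
    rewrite /= /gamma_entry; case: uv e => [[u|] [v|]] //= _;
      rewrite ?eqxx ?(negbTE (block_label_neq0 _)) ?gamma_clique_indic //.
    rewrite /joined -prod_indic; apply: eq_bigr => l1 _.
    by rewrite prod_indic.
  over.
rewrite prod_indic; congr (_%:R); congr nat_of_bool.
apply/forall_inP/andP => [H|[/forallP H1 /forallP H2] [[u|] [v|]] //= /andP[e _]].
- have H' x y : extended_edge alpha x y -> edge_ok kappa x y.
    move=> e; have [oxy|oxy] := boolP (@o (option B) (extended_graph alpha pi) x y).
      by apply: (H (x, y)); rewrite /= e oxy.
    rewrite edge_ok_sym; apply: (H (y, x)) => /=.
    have e' : edge (extended_graph alpha pi) y x by rewrite edge_sym.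
    by rewrite -[extended_edge _ _ _]/(edge (extended_graph alpha pi) y x) e' /=
       (o_orients e').
  split; apply/forallP => u.
    by apply/forallP => v; apply/implyP => /(H' (Some u) (Some v)).
  by apply/implyP => /(H' (Some u) None).
- by have /forallP/(_ v)/implyP := H1 u; apply.
- by have /implyP := H2 u; apply.
- by have /implyP := H2 v; apply.
Qed.

(** The value at xi is free. This lets the sum over blocks be rewritten over the index set of [rho],
    the factor [n.+1] compensating the extra normalization. *)
Lemma sum_option (M : nmodType) (F : (B -> 'I_n.+1) -> M) :
  \sum_(kappa : {ffun option B -> 'I_n.+1}) F (kappa \o Some) =
  (\sum_(kappa : {ffun B -> 'I_n.+1}) F kappa) *+ n.+1.
Proof.
pose ext (ik : 'I_n.+1 * {ffun B -> 'I_n.+1}) : {ffun option B -> 'I_n.+1} :=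
  [ffun x => if x is Some u then ik.2 u else ik.1].
rewrite (reindex ext) /=; last first.
  exists (fun k => (k None, [ffun u => k (Some u)])) => [[i k] _|k _].
    by rewrite /ext ffunE /=; congr pair; apply/ffunP => u; rewrite !ffunE.
  by apply/ffunP => -[u|]; rewrite !ffunE.
rewrite -(pair_bigA _ (fun i k => F (ext (i, k) \o Some))) /=.
rewrite (eq_bigr (fun=> \sum_(k : {ffun B -> 'I_n.+1}) F k)) => [|i _].
  by rewrite sumr_const card_ord.
by apply: eq_bigr => k _; congr F; apply/funext => u /=; rewrite ffunE.
Qed.

(** The two summands agree on injective assignments of [option B] and differ by at most 1 elsewhere.
    The non-injective ones take at most [#|B|] values, so [card_small_image] makes them one power of
    [n.+1] fewer than the normalization. *)
Lemma rho_pairing_estimate :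
  `|rho o (pairing_dgraph R J alpha pi) (graphon_of (grid_dgraph R g)) -
    n.+1%:R^-1 ^+ #|B| *
      \sum_(kappa : {ffun B -> 'I_n.+1} | injectiveb kappa)
        (labels_adjacent J alpha g kappa)%:R| <= (#|B| ^ #|B|.+1)%N%:R / n.+1%:R.
Proof.
rewrite rho_graphon_of.
pose Lab (kappa : B -> 'I_n.+1) : R :=
  (`[< injective kappa >] && labels_adjacent J alpha g kappa)%:R.
have -> : \sum_(kappa : {ffun B -> 'I_n.+1} | injectiveb kappa)
        (labels_adjacent J alpha g kappa)%:R =
    n.+1%:R^-1 * \sum_(kappa : {ffun option B -> 'I_n.+1}) Lab (kappa \o Some) :> R.
  rewrite sum_option -[X in _ * X]mulr_natl mulrA mulVf ?pnatr_eq0 // mul1r.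
  rewrite big_mkcond /=; apply: eq_bigr => k _; rewrite /Lab.
  have -> : injectiveb k = `[< injective k >] by apply/injectiveP/asboolP.
  by case: asbool.
rewrite [_ * (_ * _)]mulrA -exprSr card_option -mulrBr -sumrB normrM.
rewrite ger0_norm ?exprn_ge0 //.
pose bad :=
  [set k : {ffun option B -> 'I_n.+1} | (#|k @: [set: option B]| <= #|B|)%N].
have card_bad : (#|bad| <= n.+1 ^ #|B| * #|B| ^ #|B|.+1)%N.
  by apply: leq_trans (card_small_image _ _ _) _; rewrite card_option.
have -> : (#|B| ^ #|B|.+1)%N%:R / n.+1%:R =
    n.+1%:R^-1 ^+ #|B|.+1 * (n.+1 ^ #|B| * #|B| ^ #|B|.+1)%N%:R :> R.
  move: (#|B| ^ _)%N => c; rewrite natrM natrX exprSr mulrACA -exprMn.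
  by rewrite mulVf ?pnatr_eq0 // expr1n mul1r mulrC.
rewrite ler_wpM2l ?exprn_ge0 //; apply: le_trans (ler_norm_sum _ _ _) _.
rewrite -(ler_nat R) in card_bad; apply: le_trans card_bad.
rewrite -sum1_card natr_sum [leRHS]big_mkcond /=; apply: ler_sum => k _.
rewrite finset.inE -/(weight k); case: leqP => im.
  have := weight01 k; have : 0 <= Lab (k \o Some) <= 1 by exact: indic01.
  by rewrite ler_norml; lra.
have kinj : injective k.
  have /imset_injP kinj : #|k @: [set: option B]| == #|[set: option B]|.
    by rewrite eqn_leq leq_imset_card finset.cardsT card_option.
  by move=> u v; apply: kinj; rewrite finset.in_setT.
rewrite weight_inj // /Lab asboolT ?subrr ?normr0 //.
by move=> u v /kinj [].
Qed.

End Pairing.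
End StepRho.

(** * Moment estimates *)

Section Moments.
Context {R : realType} {L : nat} (A : ncps R) (a : A).
Hypothesis a_norm : normalized a.

Lemma normcR (r : R) : `|r%:C| = `|r|%:C.
Proof. by rewrite normc_def /= expr0n addr0 sqrtr_sqr. Qed.

Section Fixed.
Context {p : nat}.
Variables (J : 'I_p -> nzset L) (alpha : 'I_p -> bool).

(** All these words carry the same list of polynomials, copies of ['X], so [word_bound] gives one
    constant for all sizes, graphs and variables. Only maps of the second kind in
    [letters_trichotomy] contribute to the error. *)
Lemma word_sum_estimate : exists2 C : R, 0 <= C &
  forall n (g : sgraph ('I_n * 'I_L)%type) (x : 'I_n -> 'I_L -> A),
    graph_iid g a x ->
    `|\sum_(k : {ffun 'I_p -> 'I_n})
        tau A (eval_word (fun v => x v.1 v.2)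
                [seq (v, 'X) | v <- letters J alpha k]) -
      (\sum_(pi | compatible_pair_partition J pi)
         \sum_(kappa : {ffun block pi -> 'I_n} | injectiveb kappa)
            (labels_adjacent J alpha g kappa)%:R)%:C| <=
    (C * #|[set k : {ffun 'I_p -> 'I_n} |
              (#|[set k r | r : 'I_p]|.*2 < p)%N]|%:R)%:C.
Proof.
have [C0 HC0] := word_bound (nseq (size (positions J alpha)) 'X) (centerable_law a).
exists (complex.Re `|C0|); first by rewrite -ler0c RRe_real ?normr_ge0 // normr_real.
move=> n g x [_ xa xg].
pose x' (v : 'I_n * 'I_L) := x v.1 v.2.
have gT : graph_functional (edge g) (law_of a) (fun w => tau A (eval_word x' w)).
  by apply: graph_functional_tau => // -[k l]; apply: xa.
set T := fun w => tau A (eval_word x' w) in gT.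
rewrite (bigID (fun k : {ffun 'I_p -> 'I_n} =>
  compatible_pair_partition J (kernel_partition k))) /=.
rewrite (partition_big (fun k : {ffun 'I_p -> 'I_n} => kernel_partition k)
  (compatible_pair_partition J)) //=.
have -> : \sum_(pi | compatible_pair_partition J pi)
   \sum_(k : {ffun 'I_p -> 'I_n} |
      compatible_pair_partition J (kernel_partition k) && (kernel_partition k == pi))
     T [seq (v, 'X) | v <- letters J alpha k] =
   (\sum_(pi | compatible_pair_partition J pi)
         \sum_(kappa : {ffun block pi -> 'I_n} | injectiveb kappa)
            (labels_adjacent J alpha g kappa)%:R)%:C.
  rewrite rmorph_sum; apply: eq_bigr => pi cpi.
  rewrite (eq_bigl (fun k : {ffun 'I_p -> 'I_n} => kernel_partition k == pi)); last first.
    by move=> k; rewrite andb_idl // => /eqP->.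
  rewrite (sum_kernel cpi) rmorph_sum; apply: eq_bigr => kappa /injectiveP kinj /=.
  rewrite rmorph_nat.
  have -> : [ffun r => kappa (block_of cpi r)] =
      (fun r => kappa (block_of cpi r)) :> (_ -> _).
    by apply/funext => r; rewrite ffunE.
  rewrite -[LHS]/(T _) (pairing_word_value (@edge_sym _ g) (centerable_law a)
    (law_of_X a_norm) (law_of_XX a_norm) gT); last first.
    by move=> v; exact: count_letters_pairing.
  have iffc := @crossings_adjacent_letters _ _ _ alpha _ cpi _ g _ kinj.
  by congr (_%:R); congr nat_of_bool; apply/asboolP/idP => /iffc.
rewrite addrC addrK; apply: le_trans (ler_norm_sum _ _ _) _.
rewrite -sum1_card natr_sum mulr_sumr rmorph_sum big_mkcond [leRHS]big_mkcond /=.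
apply: ler_sum => k _; rewrite finset.inE mulr1.
have TC : `|T [seq (v, 'X) | v <- letters J alpha k]| <= (complex.Re `|C0|)%:C.
  rewrite RRe_real ?normr_real //.
  have H : `|T [seq (v, 'X) | v <- letters J alpha k]| <= C0.
    apply: (HC0 _ _ _ _ gT); rewrite lettersE -!map_comp.
    by elim: (positions J alpha) => //= y t ->.
  by rewrite [X in _ <= X]ger0_norm // (le_trans _ H).
have C00 : 0 <= (complex.Re `|C0|)%:C by apply: le_trans TC; rewrite normr_ge0.
have [ck|nck] := boolP (compatible_pair_partition _ _); first by case: ifP.
have [[v cv]|lt|cpt] := letters_trichotomy J alpha k.
- rewrite -/(T _) (single_letter_vanish (v := v) (centerable_law a) gT) ?normr0.
  + by case: ifP.
  + by rewrite -map_comp map_id_in.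
  + move=> q /mapP[u _ [_ ->]]; exact: law_of_X.
- by rewrite lt.
- by rewrite cpt in nck.
Qed.

Lemma card_pairing pi : compatible_pair_partition J pi -> p = (#|{: block pi}|).*2.
Proof.
case/andP=> /andP[part /forall_inP pair] _.
have := finset.card_partition part; rewrite finset.cardsT card_ord => {1}->.
rewrite (eq_bigr (fun=> 2%N)) => [|b /pair/eqP //].
by rewrite sum_nat_const card_sig muln2.
Qed.

Lemma invsqrt_ge0 n : 0 <= (Num.sqrt (n%:R : R))^-1.
Proof. by rewrite invr_ge0 sqrtr_ge0. Qed.

Lemma invsqrt_sqr n : (Num.sqrt (n%:R : R))^-1 ^+ 2 = n%:R^-1.
Proof. by rewrite exprVn sqr_sqrtr. Qed.

Lemma invsqrt_le1 n : (Num.sqrt (n.+1%:R : R))^-1 <= 1.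
Proof.
rewrite invf_le1 ?sqrtr_gt0 ?ltr0n // -[leLHS]sqrtr1 ler_sqrt ?ler0n //.
by rewrite ler1n.
Qed.

Lemma joint_moment_estimate (o : orientation) : is_orientation o ->
  (0 < p)%N -> exists C : R,
  forall n (g : sgraph ('I_n * 'I_L)%type) (x : 'I_n -> 'I_L -> A), (0 < n)%N ->
    graph_iid g a x ->
    `|joint_moment (grid_sum x) J alpha -
      (\sum_(pi | compatible_pair_partition J pi)
        rho o (pairing_dgraph R J alpha pi) (graphon_of (grid_dgraph R g)))%:C| <=
    (C * (Num.sqrt n%:R)^-1)%:C.
Proof.
move=> oo p0; have [C C0 HC] := word_sum_estimate.
(* The largest [m] with [2 * m < p], hence a bound on the number of values of the maps in the error
   term. *)
pose m := (p.-1)./2.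
have mp : (m * 2 < p)%N.
  by rewrite muln2 -(prednK p0) ltnS -[leqRHS]odd_double_half leq_addl.
pose K : R := \sum_(pi | compatible_pair_partition J pi)
  (#|{: block pi}| ^ #|{: block pi}|.+1)%N%:R.
exists (C * (m ^ p)%N%:R + K) => -[//|n] g x _ iid.
have xsa : forall k l, adj (x k l) = x k l by case: iid.
rewrite joint_moment_expansion //; set s := (Num.sqrt _)^-1.
have := HC _ _ _ iid; set T := (X in `|X - _|); set Y := (X in `|_ - X%:C|) => TY.
rewrite -/T; set Z := (X in `|_ - X%:C|).
have s0 : 0 <= s := invsqrt_ge0 _.
have s1 : s <= 1 := invsqrt_le1 _.
(* Two errors are separated: the maps with small image, and the replacement of counts of injections
   by densities [rho]. *)
rewrite (_ : _ - _ = (s ^+ p)%:C * (T - Y%:C) + (s ^+ p * Y - Z)%:C); last first.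
  by rewrite mulrBr -rmorphM /= rmorphB /= addrA subrK.
apply: le_trans (ler_normD _ _) _.
rewrite [X in _ <= X%:C]mulrDl [leRHS]rmorphD; apply: lerD.
  rewrite normrM normcR (ger0_norm (exprn_ge0 _ s0)).
  apply: (@le_trans _ _ ((s ^+ p)%:C *
    (C * #|[set k : {ffun 'I_p -> 'I_n.+1} |
              (#|[set k r | r : 'I_p]|.*2 < p)%N]|%:R)%:C)).
    by apply: ler_wpM2l; [rewrite ler0c exprn_ge0|exact: TY].
  rewrite -rmorphM lecR mulrCA -mulrA ler_wpM2l //.
  have cb : (#|[set k : {ffun 'I_p -> 'I_n.+1} | (#|[set k r | r : 'I_p]|.*2 < p)%N]| <=
      n.+1 ^ m * m ^ p)%N.
    rewrite -[in (m ^ p)%N](card_ord p).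
    apply: leq_trans (card_small_image _ n m); apply: subset_leq_card.
    apply/fintype.subsetP => k; rewrite !finset.inE => lt.
    rewrite (_ : k @: [set: 'I_p] = [set k r | r : 'I_p]); last first.
      by apply/setP => i; apply/imsetP/imsetP => -[r _ ->]; exists r.
    by rewrite -[leqLHS]doubleK half_leq // -ltnS prednK.
  rewrite -(ler_nat R) natrM natrX in cb.
  apply: le_trans (ler_wpM2l _ cb) _; first by rewrite exprn_ge0.
  rewrite mulrA mulrC ler_wpM2l //.
  (* The factor [s ^+ (2 * m)] cancels [n.+1 ^ m]. As [2 * m < p], at least one [s] remains, which
     gives the rate; the others are at most 1. *)
  have -> : p = (2 * m + (p - m * 2).-1.+1)%N by clear -mp; lia.
  rewrite exprD exprM invsqrt_sqr mulrAC -exprMn mulVf ?pnatr_eq0 //.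
  rewrite expr1n mul1r.
  by rewrite exprS ler_piMr // exprn_ile1.
rewrite normcR lecR /Y /Z mulr_sumr -sumrB /K mulr_suml.
apply: le_trans (ler_norm_sum _ _ _) _; apply: ler_sum => pi cpi.
have -> : s ^+ p = n.+1%:R^-1 ^+ #|{: block pi}|.
  by rewrite [in LHS](card_pairing cpi) -muln2 mulnC exprM invsqrt_sqr.
rewrite distrC.
apply: le_trans (rho_pairing_estimate alpha cpi oo g) _.
rewrite ler_wpM2l // -invsqrt_sqr expr2 ler_piMr //.
Qed.

End Fixed.
End Moments.

(** * Limits of real and complex sequences *)

Section Limits.
Context {R : realType}.
Local Open Scope classical_set_scope.

Lemma cvg_invsqrt : (fun n => (Num.sqrt (n%:R : R))^-1) @ \oo --> (0 : R).
Proof.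
rewrite -cvg_shiftS /=.
have -> : (fun n : nat => (Num.sqrt (n.+1%:R : R))^-1) = Num.sqrt \o harmonic.
  by apply/funext => n /=; rewrite sqrtrV.
have : Num.sqrt \o harmonic @ \oo --> Num.sqrt (0 : R).
  by apply: continuous_cvg; [exact: sqrt_continuous | exact: cvg_harmonic].
by rewrite sqrtr0.
Qed.

Lemma cvg_complex_squeeze (M : nat -> R[i]) (r e : nat -> R) (l : R) :
  (forall n, (0 < n)%N -> `|M n - (r n)%:C| <= (e n)%:C) ->
  r @ \oo --> l -> e @ \oo --> 0 ->
  (M : nat -> R[i]^o) @ \oo --> (l%:C : R[i]^o).
Proof.
move=> Me rl e0; apply/cvgrPdist_le => eps eps0.
have epsE : eps = (complex.Re eps)%:C by rewrite RRe_real // gtr0_real.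
have d0 : 0 < complex.Re eps / 2 by rewrite divr_gt0 // -ltcR -epsE.
have /cvgrPdist_le/(_ _ d0) rn := rl.
have /cvgrPdist_le/(_ _ d0) en := e0.
near=> n.
have -> : l%:C - M n = (l - r n)%:C - (M n - (r n)%:C).
  by rewrite rmorphB /= opprB addrA subrK.
apply: le_trans (ler_normB _ _) _.
rewrite epsE (splitr (complex.Re eps)) [leRHS]rmorphD; apply: lerD.
  by rewrite normcR lecR; near: n.
apply: le_trans (Me _ _) _; first by near: n; exists 1%N.
rewrite lecR; apply: (@le_trans _ _ `|0 - e n|); last by near: n.
by rewrite sub0r normrN ler_norm.
Unshelve. all: by end_near.
Qed.

End Limits.

(** * The limit space *)

Lemma cvg_lincomb (K : numFieldType) (u v : nat -> K^o) (c l m : K^o) :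
  (u @ \oo --> l -> v @ \oo --> m ->
  (fun n => c * u n + v n) @ \oo --> c * l + m)%classic.
Proof.
by move=> ul vm; apply: cvgD => //; apply: cvgM => //; exact: cvg_cst.
Qed.

Section ComplexLimits.
Local Open Scope classical_set_scope.
Context {R : realType}.
Implicit Types (u v : nat -> R[i]) (c l m : R[i]).

Definition tends u l : Prop := (u : nat -> R[i]^o) @ \oo --> (l : R[i]^o).

Lemma tends_cst c : tends (fun=> c) c.
Proof. exact: cvg_cst. Qed.

Lemma tends_lincomb u v c l m :
  tends u l -> tends v m -> tends (fun n => c * u n + v n) (c * l + m).
Proof. exact: (@cvg_lincomb R[i]). Qed.

Lemma tends_unique u l m : tends u l -> tends u m -> l = m.
Proof. by move=> ul um; exact: (cvg_unique _ ul um). Qed.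

(** Nonnegativity in [R[i]] means that the imaginary part is zero and the real part nonnegative;
    both pass to the limit separately. *)
Lemma tends_ge0 u l : tends u l -> (forall n, 0 <= u n) -> 0 <= l.
Proof.
move=> ul u0; have close (e : R) : 0 < e -> exists n, `|l - u n| <= e%:C.
  move=> e0; have /cvgrPdist_le/(_ e%:C) := ul.
  by rewrite ltcR => /(_ e0) [n _ /(_ n (leqnn n))]; exists n.
rewrite lecE /=; apply/andP; split.
  rewrite -normr_eq0 eq_le normr_ge0 andbT.
  apply/ler_addgt0Pr => e e0; rewrite add0r; have [n un] := close _ e0.
  have /andP[/eqP un0 _] : (complex.Im (u n) == 0) && (0 <= complex.Re (u n)).
    by have := u0 n; rewrite lecE.
  have : `|complex.Im (l - u n)|%:C <= e%:C.
    by apply: le_trans un; rewrite normc_def lecR -sqrtr_sqr ler_wsqrtr // lerDr sqr_ge0.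
  by rewrite lecR raddfB /= un0 subr0.
apply/ler_addgt0Pr => e e0; have [n un] := close _ e0.
have /andP[_ un0] : (complex.Im (u n) == 0) && (0 <= complex.Re (u n)).
  by have := u0 n; rewrite lecE.
have : `|complex.Re (l - u n)|%:C <= e%:C.
  by apply: le_trans un; exact: normc_ge_Re.
rewrite lecR raddfB /= ler_norml; lra.
Qed.

End ComplexLimits.

(** A named copy of the function type, to which the pointwise algebra structure is attached. *)
Definition sequence_algebra (K : pzRingType) (A : algType K) := nat -> A.

Section SequenceAlgebra.
Variables (K : pzRingType) (A : algType K).
HB.instance Definition _ := GRing.NzRing.on (sequence_algebra A).
HB.instance Definition _ := GRing.Lmodule.on (sequence_algebra A).

Lemma sequence_scalerAl (c : K) (u v : sequence_algebra A) :
  c *: (u * v) = (c *: u) * v.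
Proof. by apply/funext => n; exact: scalerAl. Qed.

HB.instance Definition _ :=
  GRing.Lmodule_isLalgebra.Build K (sequence_algebra A) sequence_scalerAl.

Lemma sequence_scalerAr (c : K) (u v : sequence_algebra A) :
  c *: (u * v) = u * (c *: v).
Proof. by apply/funext => n; exact: scalerAr. Qed.

HB.instance Definition _ :=
  GRing.Lalgebra_isAlgebra.Build K (sequence_algebra A) sequence_scalerAr.
End SequenceAlgebra.

Section StarPolynomials.
Context {R : realType} {A : ncps R} {I : Type}.
Variable S : nat -> I -> A.

Definition star_word n (w : seq (I * bool)) : A :=
  \prod_(z <- w) adj_pow z.2 (S n z.1).

Definition star_comb n (t : seq (R[i] * seq (I * bool))) : A :=
  \sum_(y <- t) y.1 *: star_word n y.2.

(* Membership in the *-algebra of sequences generated by the [S^(n) i]. *)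
Definition star_poly : {pred sequence_algebra A} :=
  fun f => `[< exists t, f = star_comb^~ t >].

Lemma star_poly_closed : GRing.subsemialg_closed star_poly.
Proof.
apply: GRing.subalg_closed_semi; split.
- apply/asboolP; exists [:: (1, [::])]; apply/funext => n.
  by rewrite /star_comb big_seq1 /star_word big_nil scale1r.
- move=> c f h /asboolP[t ->] /asboolP[t' ->]; apply/asboolP.
  exists ([seq (c * y.1, y.2) | y <- t] ++ t'); apply/funext => n.
  rewrite /star_comb big_cat big_map /=; congr (_ + _).
  by rewrite [LHS]scaler_sumr; apply: eq_bigr => y _; rewrite scalerA.
- move=> f h /asboolP[t ->] /asboolP[t' ->]; apply/asboolP.
  exists [seq (y.1 * y'.1, y.2 ++ y'.2) | y <- t, y' <- t']; apply/funext => n.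
  rewrite /star_comb big_allpairs_dep [LHS]mulr_suml; apply: eq_bigr => y _.
  rewrite mulr_sumr; apply: eq_bigr => y' _.
  by rewrite /star_word /= big_cat -scalerAl -scalerAr scalerA.
Qed.

Lemma star_poly_adj f : f \in star_poly -> (fun n => adj (f n)) \in star_poly.
Proof.
move=> /asboolP[t ->]; apply/asboolP.
exists [seq (y.1^*, rev [seq (z.1, ~~ z.2) | z <- y.2]) | y <- t].
apply/funext => n; rewrite /star_comb adj_sum big_map; apply: eq_bigr => y _ /=.
rewrite nc_adjZ /star_word adj_prod -map_rev big_map; congr (_ *: _).
by apply: eq_bigr => -[i []] _ //=; rewrite adjK.
Qed.

Definition limit_algebra := {f : sequence_algebra A | star_poly f}.
HB.instance Definition _ := SubChoice.on limit_algebra.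
HB.instance Definition _ := GRing.SubChoice_isSubAlgebra.Build _ _ _ limit_algebra
  star_poly_closed.

Definition limit_adj (f : limit_algebra) : limit_algebra :=
  exist _ (fun n => adj (val f n)) (star_poly_adj (valP f)).

Definition limit_generator (i : I) : limit_algebra.
Proof.
exists (S^~ i); apply/asboolP; exists [:: (1, [:: (i, false)])].
by apply/funext => n; rewrite /star_comb big_seq1 /star_word big_seq1 scale1r.
Defined.

Local Open Scope classical_set_scope.

Hypothesis S_cvg : forall (p : nat) (J : 'I_p -> I) (alpha : 'I_p -> bool),
  exists l, tends (fun n => joint_moment (S n) J alpha) l.

Lemma star_word_tends w : exists l, tends (fun n => tau A (star_word n w)) l.
Proof.
have [l Jl] := S_cvg (fun r => (tnth (in_tuple w) r).1)
  (fun r => (tnth (in_tuple w) r).2).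
exists l; rewrite (_ : (fun n => _) = fun n => joint_moment (S n)
   (fun r => (tnth (in_tuple w) r).1) (fun r => (tnth (in_tuple w) r).2)) //.
by apply/funext => n; rewrite /joint_moment /star_word big_tnth.
Qed.

Lemma star_comb_tends t : exists l, tends (fun n => tau A (star_comb n t)) l.
Proof.
elim: t => [|y t [m tm]].
  exists 0; rewrite (_ : (fun n => _) = fun=> 0); first exact: tends_cst.
  by apply/funext => n; rewrite /star_comb big_nil linear0.
have [l yl] := star_word_tends y.2; exists (y.1 * l + m).
rewrite (_ : (fun n => _) = fun n =>
    y.1 * tau A (star_word n y.2) + tau A (star_comb n t)).
  exact: tends_lincomb.
by apply/funext => n; rewrite /star_comb big_cons linearD linearZ.
Qed.

Lemma limit_algebra_tends (f : limit_algebra) :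
  exists l, tends (fun n => tau A (val f n)) l.
Proof. by case: f => f /= /asboolP[t ->]; exact: star_comb_tends. Qed.

(** A limit is picked by [cid]; linearity and the value at 1 then follow from uniqueness of limits
    and the same identity at each index. *)
Definition limit_tau (f : limit_algebra) : R[i] := sval (cid (limit_algebra_tends f)).

Lemma limit_tau_tends f : tends (fun n => tau A (val f n)) (limit_tau f).
Proof. exact: svalP (cid (limit_algebra_tends f)). Qed.

Lemma limit_tau_linear : scalar limit_tau.
Proof.
move=> c f h; apply: (tends_unique (@limit_tau_tends (c *: f + h))).
rewrite (_ : (fun n => _) = fun n => c * tau A (val f n) + tau A (val h n)).
  by apply: tends_lincomb; exact: limit_tau_tends.
by apply/funext => n; rewrite -[in RHS]linearZ -linearD.
Qed.

HB.instance Definition _ :=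
  GRing.isLinear.Build R[i] limit_algebra R[i] *%R limit_tau limit_tau_linear.

Lemma limit_val_lin c (f h : limit_algebra) n :
  val (c *: f + h) n = c *: val f n + val h n.
Proof. by rewrite linearP. Qed.

Lemma limit_val_mul (f h : limit_algebra) n : val (f * h) n = val f n * val h n.
Proof. by rewrite rmorphM. Qed.

Lemma limit_adjK f : limit_adj (limit_adj f) = f.
Proof. by apply: val_inj; apply/funext => n; exact: adjK. Qed.

Lemma limit_adj_antilinear c f h :
  limit_adj (c *: f + h) = c^* *: limit_adj f + limit_adj h.
Proof.
apply: val_inj; apply/funext => n; rewrite limit_val_lin -adj_antilinear.
by rewrite -limit_val_lin.
Qed.

Lemma limit_adjM f h : limit_adj (f * h) = limit_adj h * limit_adj f.
Proof.
apply: val_inj; apply/funext => n; rewrite limit_val_mul -adjM.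
by rewrite -limit_val_mul.
Qed.

Lemma limit_tau1 : limit_tau 1 = 1.
Proof.
apply: (tends_unique (@limit_tau_tends _)).
rewrite (_ : (fun n => _) = fun=> 1); first exact: tends_cst.
by apply/funext => n; exact: tau1.
Qed.

Lemma limit_tau_ge0 f : 0 <= limit_tau (limit_adj f * f).
Proof. by apply: (tends_ge0 (@limit_tau_tends _)) => n; exact: tau_ge0. Qed.

Definition limit_ncps : ncps R :=
  @Ncps R limit_algebra limit_adj limit_tau limit_adjK limit_adj_antilinear
    limit_adjM limit_tau1 limit_tau_ge0.

(** Evaluation of a sequence at index [n] respects products and adjoints, so [limit_tau] of a word
    in the generators is the limit of the joint moments by construction. *)
Lemma limit_generator_cvg :
  converges_in_star_distribution S (limit_generator : I -> limit_ncps).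
Proof.
move=> p J alpha; rewrite -/(tends _ _).
have := @limit_tau_tends
  (\prod_(r < p) adj_pow (alpha r) (limit_generator (J r) : limit_ncps)).
rewrite (_ : (fun n => _) = fun n => joint_moment (S n) J alpha) //.
apply/funext => n; congr (tau A _).
pose ev (f : limit_ncps) : A := val (f : limit_algebra) n.
have evM : {morph ev : f h / f * h >-> f * h} by [].
have ev1 : ev 1 = 1 by [].
rewrite -[LHS]/(ev _) (big_morph ev evM ev1); apply: eq_bigr => r _.
by case: (alpha r).
Qed.

End StarPolynomials.

(** * Convergence of the joint moments and the limit theorem *)

Local Open Scope classical_set_scope.
Local Open Scope complex_scope.
Local Open Scope ring_scope.

Lemma joint_moment0 (R : realType) (A : ncps R) (I : Type) (s : I -> A)
    (J : 'I_0 -> I) (alpha : 'I_0 -> bool) : joint_moment s J alpha = 1.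
Proof. by rewrite /joint_moment big_ord0 tau1. Qed.

(** The moment is within a constant times the inverse square root of [n] of a finite sum of
    densities in the step graphons, each converging by hypothesis. *)
Lemma joint_moment_cvg (R : realType) (L : nat) (o : orientation)
    (w : dgraphon R L) (g : forall n : nat, sgraph ('I_n * 'I_L)%type)
    (A : ncps R) (a : A) (x : forall n : nat, 'I_n -> 'I_L -> A)
    (p : nat) (J : 'I_p -> nzset L) (alpha : 'I_p -> bool) :
  is_orientation o -> dgraph_converges o (fun n => grid_dgraph R (g n)) w ->
  normalized a -> (forall n : nat, (1 <= n)%N -> graph_iid (g n) a (x n)) ->
  (0 < p)%N ->
  tends (fun n => joint_moment (grid_sum (x n)) J alpha)
    (\sum_(pi | compatible_pair_partition J pi)
        rho o (pairing_dgraph R J alpha pi) w)%:C.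
Proof.
move=> oo gw an iid p0; have [C HC] := joint_moment_estimate an J alpha oo p0.
apply: cvg_complex_squeeze (fun n n0 => HC n (g n) (x n) n0 (iid n n0)) _ _.
  by apply: cvg_big => [|pi _]; [exact: add_continuous|exact: gw].
by rewrite -(mulr0 C); apply: cvgM cvg_invsqrt; exact: cvg_cst.
Qed.

Theorem theorem3p1 (R : realType) (L : nat) (L_ge1 : (1 <= L)%N)
    (o : orientation) (o_orients : is_orientation o)
    (w : dgraphon R L)
    (g : forall n : nat, sgraph ('I_n * 'I_L)%type)
    (g_cvg : dgraph_converges o (fun n => grid_dgraph R (g n)) w)
    (A : ncps R) (a : A) (a_normalized : normalized a)
    (x : forall n : nat, 'I_n -> 'I_L -> A)
    (x_iid : forall n : nat, (1 <= n)%N -> graph_iid (g n) a (x n)) :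
  exists (B : ncps R) (s : nzset L -> B),
    [/\ converges_in_star_distribution (fun n => grid_sum (x n)) s,
        (* the distribution of the limit depends only on [w] *)
        (forall (g' : forall n : nat, sgraph ('I_n * 'I_L)%type)
                (A' : ncps R) (a' : A') (x' : forall n : nat, 'I_n -> 'I_L -> A')
                (B' : ncps R) (s' : nzset L -> B'),
           dgraph_converges o (fun n => grid_dgraph R (g' n)) w ->
           normalized a' ->
           (forall n : nat, (1 <= n)%N -> graph_iid (g' n) a' (x' n)) ->
           converges_in_star_distribution (fun n => grid_sum (x' n)) s' ->
           same_star_distribution s' s)
      & forall (p : nat) (J : 'I_p -> nzset L) (alpha : 'I_p -> bool),
          (1 <= p)%N ->
          joint_moment s J alpha =
            (\sum_(pi | compatible_pair_partition J pi)
                rho o (pairing_dgraph R J alpha pi) w)%:C].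
Proof.
pose S n := grid_sum (x n).
have S_cvg (p : nat) (J : 'I_p -> nzset L) (alpha : 'I_p -> bool) :
    exists l, tends (fun n => joint_moment (S n) J alpha) l.
  case: p J alpha => [|p] J alpha.
    exists 1; rewrite (_ : (fun n => _) = fun=> 1); first exact: tends_cst.
    by apply/funext => n; rewrite joint_moment0.
  by eexists; exact: joint_moment_cvg o_orients g_cvg a_normalized x_iid _.
have s_cvg := @limit_generator_cvg _ _ _ _ S_cvg.
exists (limit_ncps S_cvg), (@limit_generator _ _ _ S).
have s_moment (p : nat) (J : 'I_p -> nzset L) (alpha : 'I_p -> bool) : (1 <= p)%N ->
    joint_moment (@limit_generator _ _ _ S : _ -> limit_ncps S_cvg) J alpha =
      (\sum_(pi | compatible_pair_partition J pi)
          rho o (pairing_dgraph R J alpha pi) w)%:C.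
  move=> p0; apply: (tends_unique (s_cvg p J alpha)).
  exact: joint_moment_cvg o_orients g_cvg a_normalized x_iid _.
(* Other data converging to the same [w] have moments with the same limits by [joint_moment_cvg],
   and limits are unique; the empty moment is 1 on both sides. *)
split=> // g' A' a' x' B' s' g'_cvg a'_norm x'_iid s'_cvg [|p] J alpha.
  by rewrite !joint_moment0.
rewrite s_moment //; apply: (tends_unique (s'_cvg p.+1 J alpha)).
exact: joint_moment_cvg o_orients g'_cvg a'_norm x'_iid _.
Qed.
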